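(* Let $C_n$ be a cycle of length $n>3$ and let $I=I(C_n)\subset S=K[x_1,\dots,x_n]$ be its edge ideal. Then for every integer $k\ge 1$ one has $\operatorname{index}(I^{[k]})>1$ if and only if $k\geq \nu_0(C_n)$. More precisely: (a) $\nu(C_n)=\lfloor n/2\rfloor$; (b) $\nu_0(C_n)=\nu(C_n)-1$; (c) if $n$ is even, then the ideal $I^{[\nu_0(C_n)]}$ has linear quotients; if $n$ is odd, then $\operatorname{index}(I^{[\nu_0(C_n)]})=2$.
   Context: $K$ is a field and $S=K[x_1,\dots,x_n]$ is the standard graded polynomial ring. $C_n$ is the simple graph on $[n]=\{1,\dots,n\}$ with edges $\{i,i+1\}$, $1\le i\le n-1$, and $\{1,n\}$. The edge ideal of a simple graph $G$ on $[n]$ is the ideal of $S$ generated by the monomials $x_ix_j$ with $\{i,j\}\in E(G)$. For a monomial ideal $J$, $G(J)$ denotes its unique minimal set of monomial generators. For a squarefree monomial ideal $I$, the $k$-th squarefree power $I^{[k]}$ is the monomial ideal generated by all squarefree monomials in $G(I^k)$. A matching of a graph $G$ is a set of edges no two of which share a vertex; $\nu(G)$ is the maximal size of a matching of $G$. Two disjoint edges $e,e'$ of $G$ form a gap if there is no edge $f\in E(G)$ with $e\cap f\neq\emptyset\neq e'\cap f$. A restricted matching is a matching in which there is one edge that forms a gap with every other edge of the matching. $\nu_0(G)$ denotes the maximal size of a restricted matching of $G$; if there is no restricted matching, one sets $\nu_0(G)=1$. A monomial ideal $J$ has linear quotients if its minimal monomial generators can be ordered $u_1,\dots,u_t$ such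 that for each $2\le i\le t$ the colon ideal $(u_1,\dots,u_{i-1}):u_i$ is generated by variables. For a nonzero graded ideal $J\subset S$ generated in a single degree $d$, with graded Betti numbers $\beta_{i,j}(J)=\dim_K\operatorname{Tor}_i^S(J,K)_j$, $J$ is called $r$ steps linear if $\beta_{i,i+j}(J)=0$ for all pairs $(i,j)$ with $0\leq i\leq r$ and $j>d$. The index of $J$ is $\operatorname{index}(J)=\sup\{r : J \text{ is } r \text{ steps linear}\}+1$ (so $\operatorname{index}(J)=\infty$ if and only if $J$ has a linear resolution). By convention the index of the zero ideal is $\infty$. *)

(* Defs.v *)
From mathcomp Require Import all_boot all_order all_algebra.
From mathcomp Require Import boolp.
From mathcomp Require Import mpoly ring.

Set Implicit Arguments.
Unset Strict Implicit.
Unset Printing Implicit Defensive.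

Import GRing.Theory.
Local Open Scope ring_scope.

(* [option nat] stands for the extended naturals, [None] being infinity. *)
Definition extnat := option nat.

Definition ext_lt (m : nat) (v : extnat) : bool :=
  if v is Some k then (m < k)%N else true.

(* The least upper bound; it is 0 for the empty set. *)
Definition sup_nat (P : nat -> Prop) : extnat :=
  match pselect (exists m, `[< forall r, P r -> (r <= m)%N >]) with
  | left bounded => Some (ex_minn bounded)
  | right _ => None
  end.

Section Graphs.
Variable n : nat.
Implicit Types (g : rel 'I_n) (e f : {set 'I_n}) (M : {set {set 'I_n}}).

Definition edges g : {set {set 'I_n}} :=
  [set [set p.1; p.2] | p : 'I_n * 'I_n & g p.1 p.2].

Definition matching g M : bool := (M \subset edges g) && trivIset M.

Definition matching_number g : nat := \max_(M | matching g M) #|M|.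

Definition gap g e e' : bool :=
  [disjoint e & e'] &&
  ~~ [exists f in edges g, (e :&: f != set0) && (e' :&: f != set0)].

Definition restricted_matching g M : bool :=
  matching g M &&
  [exists e in M, forall e' in M, (e' != e) ==> gap g e e'].

Definition restricted_matching_number g : nat :=
  if [exists M, restricted_matching g M]
  then \max_(M | restricted_matching g M) #|M|
  else 1.

End Graphs.

(* Vertices are numbered from 0 to n - 1. *)
Definition cycle_graph (n : nat) : rel 'I_n := fun i j =>
  [|| i.+1 == j, j.+1 == i,
      (val i == 0%N) && (j.+1 == n) | (val j == 0%N) && (i.+1 == n)].

(* The dimension of Z / (B :&: Z), for linear subspaces B and Z of V, as the
   supremum of the sizes of the families in Z that are linearly independent
   modulo B. *)
Definition quot_dim (K : fieldType) (V : lmodType K) (Z B : V -> Prop) :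
    extnat :=
  sup_nat (fun b => exists c : 'I_b -> V,
    (forall t, Z (c t)) /\
    (forall l : 'I_b -> K, B (\sum_t l t *: c t) -> forall t, l t = 0)).

Section Ideals.
Variables (K : fieldType) (n : nat).
Local Notation S := {mpoly K[n]}.
Implicit Types (I J G : S -> Prop) (E : 'X_{1..n} -> Prop) (g : rel 'I_n).

Definition ideal_gen G : S -> Prop := fun p =>
  exists s : seq (S * S),
    (forall c, c \in s -> G c.2) /\ p = \sum_(c <- s) c.1 * c.2.

Definition ideal_mul I J : S -> Prop :=
  ideal_gen (fun p => exists a b, [/\ I a, J b & p = a * b]).

Fixpoint ideal_pow I (k : nat) : S -> Prop :=
  if k is k'.+1 then ideal_mul I (ideal_pow I k') else fun=> True.

Definition colon I (u : S) : S -> Prop := fun p => I (p * u).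

Definition monomial_ideal E : S -> Prop :=
  ideal_gen (fun p => exists2 m, E m & p = 'X_[m]).

Definition minimal_generators J E : Prop :=
  J = monomial_ideal E /\
  forall E', (forall m, E' m -> E m) -> J = monomial_ideal E' ->
    forall m, E m -> E' m.

(* Membership in G(J), identifying a monomial with its exponent vector; the
   set E below is unique. *)
Definition mingen J (m : 'X_{1..n}) : Prop :=
  exists E, minimal_generators J E /\ E m.

Definition squarefree (m : 'X_{1..n}) : bool := [forall i, (m i <= 1)%N].

Definition squarefree_power I (k : nat) : S -> Prop :=
  monomial_ideal (fun m => mingen (ideal_pow I k) m /\ squarefree m).

Definition edge_ideal g : S -> Prop :=
  ideal_gen (fun p => exists i j, [set i; j] \in edges g /\ p = 'X_i * 'X_j).

Definition generated_by_variables J : Prop :=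
  exists V : {set 'I_n},
    J = ideal_gen (fun p => exists2 v, v \in V & p = 'X_v).

Definition linear_quotients J : Prop :=
  exists s : seq 'X_{1..n},
    [/\ uniq s,
        forall m, m \in s <-> mingen J m
      & forall i, (0 < i < size s)%N ->
          generated_by_variables
            (colon (monomial_ideal (fun m => m \in take i s))
                   'X_[nth 0%MM s i])].

(* The Koszul complex of x_1, ..., x_n over S, which is a graded free
   resolution of K (see [koszul_diffK], [koszul_exact] and [koszul_augment]
   below). An element f of S^(subsets of [n]) stands for the sum of the
   f A e_A, and e_A |-> \sum_(v in A) (-1)^(#|{u in A, u < v}|) x_v e_(A \ v).
*)
Definition koszul_mod := {ffun {set 'I_n} -> S}.

Definition koszul_diff (f : koszul_mod) : koszul_mod :=
  [ffun B : {set 'I_n} => \sum_(v | v \notin B)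
     (-1) ^+ #|[set u in B | (u < v)%N]| * ('X_v * f (v |: B))].

(* The degree j part of the tensor product of J with the i-th term of the
   Koszul complex: as that term is free on the e_A with #|A| = i, which have
   degree i, this is a sum of copies of the degree j - i part of J. *)
Definition tor_chain J (i j : nat) (f : koszul_mod) : Prop :=
  forall A, [/\ J (f A),
                #|A| != i -> f A = 0
              & forall m, m \in msupp (f A) -> (mdeg m + i)%N = j].

Definition tor_cycle J (i j : nat) (f : koszul_mod) : Prop :=
  tor_chain J i j f /\ koszul_diff f = 0.

Definition tor_boundary J (i j : nat) (f : koszul_mod) : Prop :=
  exists2 h, tor_chain J i.+1 j h & f = koszul_diff h.

(* dim_K Tor_i(J, K)_j, where Tor_i(J, -) is computed from the Koszul
   resolution of K. *)
Definition betti J (i j : nat) : extnat :=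
  quot_dim (tor_cycle J i j) (tor_boundary J i j).

Definition zero_ideal J : Prop := forall p, J p -> p = 0.

Definition generated_in_degree J (d : nat) : Prop :=
  exists G, (forall p, G p -> p \is d.-homog) /\ J = ideal_gen G.

(* For a nonzero J the degree d is unique. *)
Definition steps_linear J (r : nat) : Prop :=
  exists d, generated_in_degree J d /\
    forall i j, (i <= r)%N -> (d < j)%N -> betti J i (i + j) = Some 0%N.

(* Meaningful for J zero or generated in a single degree. *)
Definition lin_index J : extnat :=
  if `[< zero_ideal J >] then None else omap succn (sup_nat (steps_linear J)).

End Ideals.

(* Stated in an abstract ring because [ring] is too slow over {mpoly K[n]}. *)
Fact koszul_sign_swap (R : comPzRingType) (a b c e x y : R) :
  a * (x * (- e * b * (y * c))) = - (b * (y * (e * a * (x * c)))).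
Proof. ring. Qed.

Arguments cycle_graph n i j : clear implicits.
Arguments edge_ideal K {n} g.

Section KoszulResolution.
Variables (K : fieldType) (n : nat).
Local Notation S := {mpoly K[n]}.
Implicit Types (f h : koszul_mod K n) (A B : {set 'I_n}) (m : 'X_{1..n}).

Let sgn (v : 'I_n) B : S := (-1) ^+ #|[set u in B | (u < v)%N]|.

Let sgnU (u v : 'I_n) B : u \notin B ->
  sgn v (u |: B) = (-1) ^+ (u < v)%N * sgn v B.
Proof.
move=> uB; rewrite /sgn -exprD; congr (_ ^+ _).
have [uv|uv] := boolP (u < v)%N.
  have -> : [set w in u |: B | (w < v)%N] = u |: [set w in B | (w < v)%N].
    by apply/setP=> w; rewrite !inE; case: eqP => [->|//]; rewrite uv.
  by rewrite cardsU1 !inE (negbTE uB).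
rewrite add0n; apply: eq_card => w; rewrite !inE.
by case: eqP => [->|//]; rewrite (negbTE uv) !andbF.
Qed.

Lemma koszul_diffK f : koszul_diff (koszul_diff f) = 0.
Proof.
apply/ffunP=> B; rewrite !ffunE.
pose F (v u : 'I_n) := sgn v B * ('X_v * (sgn u (v |: B) *
  ('X_u * f (u |: (v |: B))))).
pose P (v u : 'I_n) := (v \notin B) && (u \notin v |: B).
have PC v u : P v u = P u v.
  by rewrite /P !inE !negb_or (eq_sym u); case: (v \in B); case: (u \in B);
     rewrite ?andbF ?andbT.
have FN v u : P v u -> F v u = - F u v.
  rewrite /P /F !inE negb_or => /and3P[vB uv uB].
  rewrite !sgnU // setUCA.
  have -> : (-1) ^+ (v < u)%N = - (-1) ^+ (u < v)%N :> S.
    have : u != v :> nat by [].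
    by case: ltngtP => // _ _; rewrite ?expr1 ?expr0 ?opprK.
  exact: koszul_sign_swap.
transitivity (\sum_v \sum_(u | P v u) F v u).
  rewrite big_mkcond /=; apply: eq_bigr => v _; rewrite ffunE /P.
  case: (v \notin B) => /=; last by rewrite big_pred0.
  by rewrite !mulr_sumr; apply: eq_bigr => u uB; rewrite /F.
rewrite pair_big_dep /= (bigID (fun p : 'I_n * 'I_n => (p.1 < p.2)%N)) /=.
rewrite [X in _ + X](reindex (fun p : 'I_n * 'I_n => (p.2, p.1))) /=; last first.
  by exists (fun p : 'I_n * 'I_n => (p.2, p.1)) => -[].
rewrite [X in _ + X](eq_big (fun p : 'I_n * 'I_n => P p.1 p.2 && (p.1 < p.2)%N)
  (fun p => - F p.1 p.2)); first by rewrite sumrN subrr.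
  move=> [v u] /=; rewrite PC -leqNgt leq_eqVlt /P !inE negb_or (inj_eq val_inj).
  by rewrite (eq_sym v); case: eqP; rewrite ?andbF.
by move=> [v u] /= /andP[/FN].
Qed.

Let mcoeff_mulU (v : 'I_n) (p : S) m :
  ('X_v * p)@_m = if (0 < m v)%N then p@_(m - U_(v))%MM else 0.
Proof.
case: ifP => mv.
  have {1}-> : m = (U_(v) + (m - U_(v)))%MM by rewrite addmC submK // lep1mP -lt0n.
  by rewrite mulrC mcoeffMX.
apply: memN_msupp_eq0; apply/negP; rewrite mulrC (perm_mem (msuppMX _ _)).
case/mapP=> k _ mE.
by rewrite mE mnmDE mnm1E eqxx in mv.
Qed.

Let divX (v : 'I_n) (p : S) : S :=
  \sum_(k <- msupp p | (0 < k v)%N && [forall u : 'I_n, (u < v)%N ==> (k u == 0%N)])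
    p@_k *: 'X_[k - U_(v)].

Let mcoeff_divX v p m : (divX v p)@_m =
  if [forall u : 'I_n, (u < v)%N ==> (m u == 0%N)] then p@_(m + U_(v)) else 0.
Proof.
rewrite raddf_sum /= (eq_bigr (fun k => p@_k * (k == (m + U_(v))%MM)%:R)); last first.
  move=> k /andP[kv _]; rewrite mcoeffZ mcoeffX; congr (_ * (nat_of_bool _)%:R).
  have kE : k = ((k - U_(v)) + U_(v))%MM by rewrite submK // lep1mP -lt0n.
  apply/eqP/eqP => [<-//|kE']; apply/mnmP=> i.
  by rewrite kE' mnmBE mnmDE addnK.
have condE : (0 < (m + U_(v))%MM v)%N && [forall u : 'I_n, (u < v)%N ==>
    ((m + U_(v))%MM u == 0%N)] = [forall u : 'I_n, (u < v)%N ==> (m u == 0%N)].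
  rewrite mnmDE mnm1E eqxx addn1 /=; apply: eq_forallb => u.
  have [uv|//] := boolP (u < v)%N; rewrite mnmDE mnm1E.
  by case: (eqVneq v u) uv => [->|_ _]; rewrite ?ltnn ?addn0.
rewrite big_mkcond /=.
have [mp|mp] := boolP ((m + U_(v))%MM \in msupp p).
  rewrite (bigD1_seq (m + U_(v))%MM) ?msupp_uniq //= condE eqxx mulr1 big1 ?addr0 //.
  by move=> k /negbTE->; rewrite mulr0 if_same.
rewrite (memN_msupp_eq0 mp) if_same big1_seq // => k /= kp.
by case: eqP kp => [->|_ _]; rewrite ?(negbTE mp) ?mulr0 ?if_same.
Qed.

Let homotopy f : koszul_mod K n := [ffun A : {set 'I_n} =>
  \sum_(v in A | [forall u in A, (v <= u)%N]) divX v (f (A :\ v))].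

Let least (v : 'I_n) A m :=
  forall u : 'I_n, (u \in A) || (0 < m u)%N -> (v <= u)%N.

Let homotopy_in f A m v : v \in A -> least v A m ->
  (homotopy f A)@_m = (f (A :\ v))@_(m + U_(v)).
Proof.
move=> vA vl; rewrite ffunE raddf_sum /= (bigD1 v) /=; last first.
  by rewrite vA; apply/forall_inP => u uA; apply: vl; rewrite uA.
rewrite mcoeff_divX ifT ?big1 ?addr0 //.
  move=> w /andP[/andP[wA /forall_inP wl] wv]; case/eqP: wv.
  by apply/val_inj/anti_leq; rewrite wl // vl ?wA.
apply/forallP=> u; apply/implyP; rewrite ltnNge; apply: contraR.
by rewrite -lt0n => mu; apply: vl; rewrite mu orbT.
Qed.

Let homotopy_notin f A m v : (0 < m v)%N -> v \notin A -> least v A m ->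
  (homotopy f A)@_m = 0.
Proof.
move=> mv vA vl; rewrite ffunE raddf_sum /= big1 // => w /andP[wA wl].
rewrite mcoeff_divX ifN //; apply/negP=> /forallP/(_ v)/implyP.
rewrite ltn_neqAle vl ?wA // andbT => /(_ _)/eqP mv0.
by rewrite mv0 // in mv; apply: contraNneq vA => /val_inj->.
Qed.

Let mcoeff_diff f B m : (koszul_diff f B)@_m = \sum_(v | v \notin B)
  (-1) ^+ #|[set u in B | (u < v)%N]| *
    (if (0 < m v)%N then (f (v |: B))@_(m - U_(v))%MM else 0).
Proof.
rewrite ffunE raddf_sum; apply: eq_bigr => v _ /=.
rewrite -mcoeff_mulU -[in LHS]signr_odd -[in RHS]signr_odd.
by case: (odd _);
   rewrite ?expr1 ?expr0 ?mulN1r ?mcoeffN ?mul1r.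
Qed.

(* Exactness at every e_A except for the constants on e_set0. *)
Lemma koszul_exact (i : nat) f :
  (forall A, #|A| != i -> f A = 0) -> koszul_diff f = 0 -> (f set0)@_0 = 0 ->
  exists2 h : koszul_mod K n,
    forall A, #|A| != i.+1 -> h A = 0 & f = koszul_diff h.
Proof.
move=> fi df0 f00; exists (homotopy f).
  move=> A Ai; rewrite ffunE big1 // => v /andP[vA _].
  rewrite fi /divX ?msupp0 ?big_nil //.
  by apply: contraNneq Ai => <-; rewrite (cardsD1 v A) vA.
apply/ffunP=> B; apply/mpolyP=> m; rewrite mcoeff_diff.
have [v0 v0P|none] := pickP (fun v : 'I_n => (v \in B) || (0 < m v)%N); last first.
  have -> : B = set0.
    by apply/setP=> v; rewrite inE; have /norP[/negbTE] := negbT (none v).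
  have -> : m = 0%MM.
    apply/mnmP=> v; rewrite mnm0E; have /norP[_] := negbT (none v).
    by rewrite -eqn0Ngt => /eqP.
  by rewrite f00 big1 // => v _; rewrite mnm0E mulr0.
have [v vP vl] := @arg_minnP _ v0 (fun v : 'I_n => (v \in B) || (0 < m v)%N)
  (fun v => val v) v0P.
have sgn0 A : (forall u, u \in A -> (v <= u)%N) -> [set u in A | (u < v)%N] = set0.
  move=> Av; apply/setP=> u; rewrite !inE; apply/negP=> /andP[/Av].
  by rewrite leqNgt => /negbTE->.
have BvE u : u \in B -> (v <= u)%N by move=> uB; apply: vl; rewrite uB.
have [vB|vB] := boolP (v \in B); last first.
  have mv : (0 < m v)%N by rewrite (negbTE vB) in vP.
  rewrite (bigD1 v) //= mv sgn0 // cards0 mul1r big1 ?addr0.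
    rewrite (@homotopy_in _ _ _ v) ?setU11 //; last first.
      move=> u; rewrite !inE => /orP[/orP[/eqP->//|]|]; first exact: BvE.
      by rewrite mnmBE => mu; apply: vl; rewrite (leq_trans mu) ?leq_subr ?orbT.
    by rewrite setU1K // submK // lep1mP -lt0n.
  move=> u /andP[uB uv]; case: ifP => mu; rewrite ?mulr0 //.
  rewrite (@homotopy_notin _ _ _ v) ?mulr0 //.
  - by rewrite mnmBE mnm1E (negbTE uv) subn0.
  - by rewrite !inE negb_or eq_sym uv.
  move=> w; rewrite !inE => /orP[/orP[/eqP->|]|]; last 2 first.
  - exact: BvE.
  - by rewrite mnmBE => mw; apply: vl; rewrite (leq_trans mw) ?leq_subr ?orbT.
  by apply: vl; rewrite mu orbT.
have /(congr1 (fun h : koszul_mod K n => (h (B :\ v))@_(m + U_(v)))) := df0.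
rewrite mcoeff_diff ffunE mcoeff0 (bigD1 v) ?setD11 //= mnmDE mnm1E eqxx addn1 /=.
rewrite sgn0 ?cards0 ?mul1r; last by move=> u /setD1P[_]; exact: BvE.
rewrite setD1K // addmK => /eqP; rewrite addr_eq0 => /eqP->.
rewrite -sumrN; apply: eq_big => [u|u /andP[]].
  by rewrite !inE negb_and negbK; case: eqP => [->|]; rewrite ?vB ?andbT.
rewrite !inE negb_and negbK => uB' uv; have uB : u \notin B.
  by rewrite (negbTE uv) in uB'.
rewrite mnmDE mnm1E eq_sym (negbTE uv) addn0.
case: ifP => mu; rewrite ?mulr0 ?oppr0 //.
have vu : (v < u)%N.
  rewrite ltn_neqAle vl ?mu ?orbT // andbT; apply: contraNneq uv.
  by move/val_inj->.
rewrite (@homotopy_in _ _ _ v); first last.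
- move=> w; rewrite !inE => /orP[/orP[/eqP->|]|]; first exact: ltnW.
    exact: BvE.
  by rewrite mnmBE => mw; apply: vl; rewrite (leq_trans mw) ?leq_subr ?orbT.
- by rewrite !inE vB orbT.
have -> : (u |: B) :\ v = u |: (B :\ v).
  by rewrite setDUl; congr (_ :|: _); apply/setP=> w; rewrite !inE;
     case: eqP => [->|]; rewrite ?andbF // eq_sym (negbTE uv).
have -> : (m + U_(v) - U_(u))%MM = (m - U_(u) + U_(v))%MM.
  apply/mnmP=> w; rewrite !(mnmBE, mnmDE, mnm1E).
  by case: (eqVneq u w) mu => [<-|_ _]; rewrite ?subn0 // => mu;
     rewrite -addnBAC.
rewrite -mulNr; congr (_ * _).
rewrite [in RHS](cardsD1 v) !inE vB vu exprS mulN1r; congr (- (-1) ^+ _).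
by apply: eq_card => w; rewrite !inE andbA.
Qed.

(* The cokernel of the last map is S / (x_1, ..., x_n) = K. *)
Lemma koszul_augment (p : S) : p@_0 = 0 <->
  exists2 h : koszul_mod K n, forall A, #|A| != 1%N -> h A = 0
    & p = koszul_diff h set0.
Proof.
split=> [p0|[h _ ->]]; last first.
  by rewrite mcoeff_diff big1 // => v _; rewrite mnm0E mulr0.
pose f : koszul_mod K n := [ffun A : {set 'I_n} => if A == set0 then p else 0].
have [||| h h1 fE] := @koszul_exact 0 f.
- by move=> A; rewrite ffunE cards_eq0 => /negbTE->.
- apply/ffunP=> B; rewrite !ffunE big1 // => v _; rewrite ffunE ifN ?mulr0 //.
  by apply/set0Pn; exists v; rewrite setU11.
- by rewrite ffunE eqxx.
by exists h => //; rewrite -fE ffunE eqxx.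
Qed.

End KoszulResolution.

(* Main.v *)
Require Import Defs.
From mathcomp Require Import all_boot all_order all_algebra.
From mathcomp Require Import boolp mpoly zify ring.

(* The Betti numbers of a monomial ideal J are the homology of its upper Koszul
   complexes, in degree a the complex of the sets A with x^a / x_A in J. For
   J = I^[k] only squarefree degrees W matter, and A is a face when the graph on
   W \ A has a k-matching. J has linear relations when all these complexes with
   #|W| >= 2k + 2 are connected.
   Write m = floor(n / 2).
   - k < m - 1: if W is an edge together with a path on 2k vertices that forms a
     gap with it, an edge of the complex lies in one part, by parity, so the
     complex is disconnected.
   - k = m - 1, n even: #|W| >= 2k + 2 leaves W = [n], where u and v are joined when
     u + v is odd. The generators x_[n] / (x_a x_b), a even and b odd, ordered
     lexicographically in (a, b), give linear quotients.
   - k = m - 1, n odd: the triangles in degree [n] are the {a, b, c} that cut the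
     cycle into arcs of odd length. All pairs are edges, and the cochain that
     vanishes on the pairs a < b with a even and b odd, and is 1 on the others,
     is a cocycle with value 1 on the boundary of the non-face {0, 1, 3}: second
     homology appears in degree n = 2k + 3. If W misses the vertex w, then
     every vertex is joined to w + 1 or to w - 1, and these are joined.
   - k >= m: no squarefree degree has the required size. *)

Set Implicit Arguments.
Unset Strict Implicit.
Unset Printing Implicit Defensive.

Import GRing.Theory.

(** * Monomial ideals, read through the supports of their elements *)

Section MonomialIdeals.
Local Open Scope ring_scope.
Variables (K : fieldType) (n : nat).
Local Notation S := {mpoly K[n]}.
Implicit Types (G J : S -> Prop) (E : 'X_{1..n} -> Prop) (m : 'X_{1..n}).

Lemma ideal_gen0 G : ideal_gen G 0.
Proof. by exists [::]; rewrite big_nil. Qed.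

Lemma ideal_genD G p q : ideal_gen G p -> ideal_gen G q -> ideal_gen G (p + q).
Proof.
move=> [s [sG ->]] [t [tG ->]]; exists (s ++ t); rewrite big_cat; split=> //.
by move=> c; rewrite mem_cat => /orP[/sG|/tG].
Qed.

Lemma ideal_genM G c g : G g -> ideal_gen G (c * g).
Proof.
move=> Gg; exists [:: (c, g)]; rewrite big_seq1; split=> // d.
by rewrite inE => /eqP->.
Qed.

Lemma ideal_gen_sum G (I : eqType) (r : seq I) (P : pred I) (F : I -> S) :
  (forall i, i \in r -> P i -> ideal_gen G (F i)) ->
  ideal_gen G (\sum_(i <- r | P i) F i).
Proof.
move=> GF; rewrite big_seq_cond; apply: (big_ind (ideal_gen G)).
- exact: ideal_gen0.
- exact: ideal_genD.
- by move=> i /andP[]; apply: GF.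
Qed.

Lemma ideal_gen_min G (Q : S -> Prop) :
  Q 0 -> (forall p q, Q p -> Q q -> Q (p + q)) ->
  (forall c g, G g -> Q (c * g)) -> forall p, ideal_gen G p -> Q p.
Proof.
move=> Q0 QD QM p [s [sG ->]]; rewrite big_seq.
by apply: big_ind => // c /sG; apply: QM.
Qed.

Lemma ideal_genMl G c p : ideal_gen G p -> ideal_gen G (c * p).
Proof.
apply: (ideal_gen_min (Q := fun p => ideal_gen G (c * p))).
- by rewrite mulr0; apply: ideal_gen0.
- by move=> u v Gu Gv; rewrite mulrDr; apply: ideal_genD.
- by move=> d g Gg; rewrite mulrA; apply: ideal_genM.
Qed.

(* The exponents of the monomials in the ideal generated by E. *)
Definition upset E m := exists2 e, E e & (e <= m)%MM.

Lemma upset_gen E m : E m -> upset E m.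
Proof. by move=> Em; exists m => //; apply: lepm_refl. Qed.

(** Membership depends on the support alone: the condition on the right is closed under sums and
    holds for multiples of generators, and conversely every term of p is then a multiple of a
    generator. *)
Lemma monomial_idealP E (p : S) :
  monomial_ideal E p <-> {in msupp p, forall m, upset E m}.
Proof.
split=> [|pE].
  apply: (@ideal_gen_min _ (fun p : S => {in msupp p, forall m, upset E m})).
  - by move=> m; rewrite msupp0.
  - by move=> u v Eu Ev m /msuppD_le; rewrite mem_cat => /orP[/Eu|/Ev].
  - move=> c _ [e Ee ->] m; rewrite (perm_mem (msuppMX _ _)) => /mapP[k _ ->].
    by exists e => //; apply: lem_addr.
rewrite [p]mpolyE; apply: ideal_gen_sum => m /pE[e Ee em] _.
by rewrite -(submK em) mpolyXD scalerAl; apply: ideal_genM; exists e.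
Qed.

Lemma monomial_idealX E m : monomial_ideal E ('X_[m] : S) <-> upset E m.
Proof.
split=> [/monomial_idealP|Em]; last apply/monomial_idealP => k.
  by apply; rewrite msuppX inE.
by rewrite msuppX inE => /eqP->.
Qed.

Lemma monomial_ideal_mcoeff E (p : S) m :
  monomial_ideal E p -> ~ upset E m -> p@_m = 0.
Proof.
move=> /monomial_idealP Ep Em; apply: memN_msupp_eq0.
by apply: contra_notN Em; apply: Ep.
Qed.

Lemma monomial_ideal0 E : monomial_ideal E (0 : S).
Proof. exact: ideal_gen0. Qed.

Lemma monomial_idealZ E c (p : S) : monomial_ideal E p -> monomial_ideal E (c *: p).
Proof. by rewrite -mul_mpolyC; apply: ideal_genMl. Qed.

Lemma lem_mdeg_eq m m' : (m <= m')%MM -> mdeg m = mdeg m' -> m = m'.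
Proof.
move=> mm; rewrite -{1 2}(submK mm) mdegD => /eqP.
by rewrite -{1}[mdeg m]add0n eqn_add2r eq_sym mdeg_eq0 => /eqP->; rewrite add0m.
Qed.

(** Two monomials of the same degree divide each other only if they are equal. Hence a monomial e of
    E lies in every monomial generating set E': some e' in E' divides e, some e'' in E divides e',
    and e'' = e by degree. *)
Lemma mingen_homog E d (Edeg : forall m, E m -> mdeg m = d) m :
  mingen (monomial_ideal (K := K) E) m <-> E m.
Proof.
have EsubE' E' : monomial_ideal (K := K) E = monomial_ideal E' ->
    forall e, E e -> E' e.
  move=> EE' e Ee.
  have : monomial_ideal (K := K) E 'X_[e] by apply/monomial_idealX/upset_gen.
  rewrite EE' => /monomial_idealX[e' Ee' e'e].
  have : monomial_ideal (K := K) E' 'X_[e'] by apply/monomial_idealX/upset_gen.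
  rewrite -EE' => /monomial_idealX[e'' Ee'' e''e'].
  have e''E : e'' = e.
    apply: lem_mdeg_eq; first exact: lepm_trans e'e.
    by rewrite !Edeg.
  suff <- : e' = e by [].
  apply/mnmP=> i; apply/eqP; rewrite eqn_leq (mnm_lepP e'e) /=.
  by rewrite -e''E; apply: (mnm_lepP e''e').
split=> [[E' [[EE' E'min] E'm]]|Em].
  by apply: (E'min E) => //; apply: EsubE'.
exists E; split=> //; split=> // E' _ EE'; exact: EsubE'.
Qed.

Lemma monomial_ideal_degree E d (Edeg : forall m, E m -> mdeg m = d) :
  generated_in_degree (monomial_ideal (K := K) E) d.
Proof.
exists (fun p => exists2 m, E m & p = 'X_[m]); split=> // p [m Em ->].
by rewrite -(Edeg _ Em) dhomogX.
Qed.

Lemma generated_in_degree_le J d m :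
  generated_in_degree J d -> J 'X_[m] -> (d <= mdeg m)%N.
Proof.
move=> [G [Gd ->]]; move=> mG.
suff: {in msupp ('X_[m] : S), forall k, d <= mdeg k}%N.
  by apply; rewrite msuppX inE.
apply: (@ideal_gen_min G (fun p : S => {in msupp p, forall k, d <= mdeg k}%N)) mG.
- by move=> k; rewrite msupp0.
- by move=> u v du dv k /msuppD_le; rewrite mem_cat => /orP[/du|/dv].
- move=> c g /Gd/dhomogP gd k /msuppM_le/allpairsP[[k1 k2] /= [_ /gd <- ->]].
  by rewrite mdegD leq_addl.
Qed.

End MonomialIdeals.

(** * Suprema in the extended naturals, determined by what lies strictly below them *)

Lemma sup_nat_gt (P : nat -> Prop) m :
  ext_lt m (sup_nat P) <-> exists2 r, P r & m < r.
Proof.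
rewrite /sup_nat; case: pselect => [bd|nbd] /=; last first.
  split=> // _; apply: contra_notP nbd => nP; exists m; apply/asboolP => r Pr.
  by rewrite leqNgt; apply: contra_notN nP => mr; exists r.
case: ex_minnP => b /asboolP Pb bmin; split=> [mb|[r /Pb rb mr]]; last first.
  exact: leq_trans rb.
apply: contrapT => nP; have /bmin : `[< forall r, P r -> r <= m >].
  apply/asboolP => r Pr; rewrite leqNgt.
  by apply: contra_notN nP => mr; exists r.
by rewrite leqNgt mb.
Qed.

Lemma ext_eqP (v : extnat) b :
  v = Some b <-> forall m, ext_lt m v = (m < b).
Proof.
split=> [->//|]; case: v => [c|] /= mb; last by have := mb b; rewrite ltnn.
by have := mb b; have := mb c; rewrite !ltnn; case: ltngtP => // ->.
Qed.

Lemma sup_nat0 (P : nat -> Prop) : sup_nat P = Some 0 <-> forall r, P r -> r = 0.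
Proof.
rewrite ext_eqP; split=> [P0 r Pr|P0 m].
  have := P0 0; rewrite ltnn; case: r Pr => // r Pr.
  by have -> : ext_lt 0 (sup_nat P) by apply/sup_nat_gt; exists r.+1.
by rewrite ltn0; apply/negP => /sup_nat_gt[r /P0->].
Qed.

(** * Koszul chains with coefficients in a monomial ideal, and vanishing of Betti numbers *)

Section Koszul.
Local Open Scope ring_scope.
Variables (K : fieldType) (n : nat).
Local Notation S := {mpoly K[n]}.
Implicit Types (J : S -> Prop) (E : 'X_{1..n} -> Prop) (m : 'X_{1..n})
  (A B : {set 'I_n}) (p q : S) (f g h : koszul_mod K n).

Lemma koszul_diffD f g : koszul_diff (f + g) = koszul_diff f + koszul_diff g.
Proof.
apply/ffunP=> B; rewrite !ffunE -big_split; apply: eq_bigr => v _.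
by rewrite ffunE !mulrDr.
Qed.

Lemma koszul_diff0 : koszul_diff (0 : koszul_mod K n) = 0.
Proof.
by apply/ffunP=> B; rewrite !ffunE big1 // => v _; rewrite ffunE !mulr0.
Qed.

Lemma koszul_diffZ c f : koszul_diff (c *: f) = c *: koszul_diff f.
Proof.
apply/ffunP=> B; rewrite !ffunE scaler_sumr; apply: eq_bigr => v _.
by rewrite ffunE -!scalerAr.
Qed.

(** The element p e_A of the Koszul module. *)
Definition kelt A p : koszul_mod K n := [ffun B => if B == A then p else 0].

Lemma keltD A p q : kelt A (p + q) = kelt A p + kelt A q.
Proof. by apply/ffunP=> B; rewrite !ffunE; case: eqP; rewrite ?addr0. Qed.

Lemma kelt0 A : kelt A 0 = 0.
Proof. by apply/ffunP=> B; rewrite !ffunE if_same. Qed.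

Lemma keltZ A c p : kelt A (c *: p) = c *: kelt A p.
Proof. by apply/ffunP=> B; rewrite !ffunE; case: eqP; rewrite ?scaler0. Qed.

Lemma kelt_sum A (I : Type) (r : seq I) (P : pred I) (F : I -> S) :
  kelt A (\sum_(i <- r | P i) F i) = \sum_(i <- r | P i) kelt A (F i).
Proof. exact: (big_morph (kelt A) (@keltD A) (kelt0 A)). Qed.

Lemma kelt_mono A p : kelt A p = \sum_(m <- msupp p) p@_m *: kelt A 'X_[m].
Proof.
by rewrite {1}[p]mpolyE kelt_sum; apply: eq_bigr => m _; rewrite keltZ.
Qed.

Lemma kelt_decomp f : f = \sum_A kelt A (f A).
Proof.
apply/ffunP=> B; rewrite sum_ffunE (bigD1 B) //= ffunE eqxx big1 ?addr0 //.
by move=> A /negbTE AB; rewrite ffunE eq_sym AB.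
Qed.

(** In [koszul_diff] the sign is counted in A \ v, the index of the target. Counting in A gives the
    same number, since v is not smaller than itself. *)
Definition ksign A (v : 'I_n) : nat := #|[set u in A | (u < v)%N]|.

Lemma koszul_diff_kelt A p : koszul_diff (kelt A p) =
  \sum_(v in A) kelt (A :\ v) ((-1) ^+ ksign A v * ('X_v * p)).
Proof.
apply/ffunP=> B; rewrite ffunE sum_ffunE.
rewrite [LHS]big_mkcond [RHS]big_mkcond /=; apply: eq_bigr => v _.
rewrite !ffunE; have [vB|vB] := boolP (v \in B); last first.
  rewrite /=; case: (eqVneq (v |: B) A) => [<-|vBA].
    rewrite setU11 setU1K // eqxx; congr (_ ^+ _ * _).
    apply: eq_card => w; rewrite !inE.
    by case: eqP => [->|//]; rewrite ltnn !andbF.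
  rewrite !mulr0; case: ifP => // vA; case: eqP => // BA.
  by rewrite BA setD1K ?eqxx in vBA.
by rewrite /=; case: ifP => // vA; case: eqP => // BA; rewrite BA setD11 in vB.
Qed.

Lemma koszul_diff_keltX A m : koszul_diff (kelt A 'X_[m]) =
  \sum_(v in A) (-1) ^+ ksign A v *: kelt (A :\ v) 'X_[U_(v) + m].
Proof.
rewrite koszul_diff_kelt; apply: eq_bigr => v _.
by rewrite -keltZ mpolyXD -mul_mpolyC rmorphXn rmorphN1.
Qed.

Lemma tor_chain0 J i j : J 0 -> tor_chain J i j 0.
Proof. by move=> J0 A; rewrite ffunE msupp0; split. Qed.

Variable E : 'X_{1..n} -> Prop.
Local Notation J := (monomial_ideal (K := K) E).

Lemma tor_chainD i j f g :
  tor_chain J i j f -> tor_chain J i j g -> tor_chain J i j (f + g).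
Proof.
move=> cf cg A; have [Jf f0 fj] := cf A; have [Jg g0 gj] := cg A.
rewrite ffunE; split; first exact: ideal_genD.
  by move=> Ai; rewrite f0 // g0 // addr0.
by move=> m /msuppD_le; rewrite mem_cat => /orP[/fj|/gj].
Qed.

Lemma tor_chainZ i j c f : tor_chain J i j f -> tor_chain J i j (c *: f).
Proof.
move=> cf A; have [Jf f0 fj] := cf A; rewrite ffunE.
split; first exact: monomial_idealZ.
  by move=> Ai; rewrite f0 // scaler0.
by move=> m /msuppZ_le /fj.
Qed.

Lemma tor_chain_kelt A m : upset E m -> tor_chain J #|A| (#|A| + mdeg m) (kelt A 'X_[m]).
Proof.
move=> Em B; rewrite ffunE; case: eqP => [->|_]; last first.
  by rewrite msupp0; split=> //; apply: monomial_ideal0.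
rewrite eqxx; split=> //; first exact/monomial_idealX.
by move=> k; rewrite msuppX inE => /eqP->; rewrite addnC.
Qed.

Lemma tor_boundary0 i j : tor_boundary J i j 0.
Proof.
by exists 0; [apply: tor_chain0; apply: monomial_ideal0|rewrite koszul_diff0].
Qed.

Lemma tor_boundaryD i j f g :
  tor_boundary J i j f -> tor_boundary J i j g -> tor_boundary J i j (f + g).
Proof.
move=> [h ch ->] [k ck ->]; exists (h + k); first exact: tor_chainD.
by rewrite koszul_diffD.
Qed.

Lemma tor_boundaryZ i j c f : tor_boundary J i j f -> tor_boundary J i j (c *: f).
Proof.
by move=> [h ch ->]; exists (c *: h); [apply: tor_chainZ|rewrite koszul_diffZ].
Qed.

Lemma tor_boundary_sum i j (I : eqType) (r : seq I) (P : pred I) F :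
  (forall t, t \in r -> P t -> tor_boundary J i j (F t)) ->
  tor_boundary J i j (\sum_(t <- r | P t) F t).
Proof.
move=> bF; rewrite big_seq_cond; apply: big_ind.
- exact: tor_boundary0.
- by move=> f g; apply: tor_boundaryD.
- by move=> t /andP[]; apply: bF.
Qed.

(** Over a field, a single cycle that is not a boundary is already an independent family of size 1
    modulo boundaries. *)
Lemma betti_eq0 i j : betti J i j = Some 0%N <->
  forall f, tor_cycle J i j f -> tor_boundary J i j f.
Proof.
rewrite /betti /quot_dim sup_nat0; split=> [J0 f cf|cb b [c [cc cl]]]; last first.
  case: b c cc cl => // b c cc cl.
  have /cl/(_ ord0)/eqP : tor_boundary J i j (\sum_t 1 *: c t).
    by apply: tor_boundary_sum => t _ _; rewrite scale1r; apply: cb.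
  by rewrite oner_eq0.
apply: contrapT => nbf; suff : 1%N = 0%N by [].
apply: J0; exists (fun=> f); split=> // l; rewrite big_ord1 => bl t; rewrite ord1.
apply: contra_notP nbf => /eqP l0.
by rewrite -[f](scalerK l0); apply: tor_boundaryZ.
Qed.

(* Read on the upper Koszul complex of the squarefree degree W, whose faces are
   the A with x^(W \ A) in J: a cocycle psi that does not vanish on the boundary
   of A0 shows that this boundary is not null-homologous. *)
Lemma betti_neq0 (W A0 : {set 'I_n}) i (psi : {set 'I_n} -> K) :
  let coboundary A := \sum_(v in A) (-1) ^+ ksign A v * psi (A :\ v) in
  A0 \subset W -> #|A0| = i.+1 ->
  (forall v, v \in A0 -> upset E (mesym1 (W :\: (A0 :\ v)))) ->
  (forall A, A \subset W -> #|A| = i.+1 -> upset E (mesym1 (W :\: A)) ->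
    coboundary A = 0) ->
  coboundary A0 != 0 ->
  betti J i #|W| <> Some 0%N.
Proof.
move=> cob A0W A0i A0J cob0 cobA0 /betti_eq0 bW.
(* L evaluates psi on the part of f in multidegree W: on e_B that part is the coefficient of x^(W \
   B). *)
pose L f : K := \sum_(B : {set 'I_n} | B \subset W) psi B * (f B)@_(mesym1 (W :\: B)).
have LD f g : L (f + g) = L f + L g.
  rewrite -big_split; apply: eq_bigr => B _.
  by rewrite ffunE mcoeffD mulrDr.
have L0 : L 0 = 0 by rewrite /L big1 // => B _; rewrite ffunE mcoeff0 mulr0.
(* Adjunction between boundary and coboundary: L after [koszul_diff] pairs with [cob]. *)
have Ldiff A p : L (koszul_diff (kelt A p)) =
    (A \subset W)%:R * p@_(mesym1 (W :\: A)) * cob A.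
  rewrite koszul_diff_kelt (big_morph L LD L0) mulr_sumr.
  apply: eq_bigr => v vA.
  have LE B q : L (kelt B q) = (B \subset W)%:R * (psi B * q@_(mesym1 (W :\: B))).
    rewrite /L; have [BW|BW] := boolP (B \subset W).
      rewrite (bigD1 B) //= ffunE eqxx mul1r big1 ?addr0 // => C /andP[_ /negbTE CB].
      by rewrite ffunE CB mcoeff0 mulr0.
    rewrite mul0r big1 // => C CW; rewrite ffunE.
    by case: eqP => [CB|_]; [rewrite -CB CW in BW|rewrite mcoeff0 mulr0].
  have mcoeff_sign k (q : S) m : ((-1) ^+ k * q)@_m = (-1) ^+ k * q@_m.
    rewrite -[in LHS]signr_odd -[in RHS]signr_odd.
    by case: (odd k); rewrite ?expr1 ?expr0 ?mulN1r ?mcoeffN ?mul1r.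
  rewrite LE mcoeff_sign.
  (* A multiple of x_v with v outside W has no term of multidegree inside W, so both sides
     vanish. *)
  have [vW|vW] := boolP (v \in W); last first.
    have -> : A \subset W = false.
      by apply: contraNF vW => /subsetP/(_ v vA).
    suff -> : ('X_v * p)@_(mesym1 (W :\: (A :\ v))) = 0 by rewrite !(mulr0, mul0r).
    apply: memN_msupp_eq0; apply/negP; rewrite mulrC (perm_mem (msuppMX _ _)).
    case/mapP=> k _ /mnmP/(_ v); rewrite mnmDE mnm1E eqxx mnmE !inE (negbTE vW).
    by rewrite andbF.
  have -> : A :\ v \subset W = (A \subset W).
    apply/subsetP/subsetP => AW w; last by rewrite !inE => /andP[_ /AW].
    by move=> wA; have [->//|wv] := eqVneq w v; apply: AW; rewrite !inE wv.
  have -> : mesym1 (W :\: (A :\ v)) = (U_(v) + mesym1 (W :\: A))%MM.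
    apply/mnmP=> w; rewrite mnmDE mnm1E !mnmE !inE.
    by case: (eqVneq v w) => [<-|vw]; rewrite ?vA ?vW.
  by rewrite ['X_v * p]mulrC mcoeffMX; ring.
(* The cycle is the boundary of x^(W \ A0) e_A0. Its terms have coefficients in J, although x^(W \
   A0) itself may lie outside J. *)
have [|h ch] := bW (koszul_diff (kelt A0 'X_[mesym1 (W :\: A0)])).
  split; last exact: koszul_diffK.
  rewrite koszul_diff_keltX; apply: (big_ind (tor_chain J i #|W|)).
  - by apply: tor_chain0; apply: monomial_ideal0.
  - exact: tor_chainD.
  move=> v vA.
  have -> : (U_(v) + mesym1 (W :\: A0))%MM = mesym1 (W :\: (A0 :\ v)).
    apply/mnmP=> w; rewrite mnmDE mnm1E !mnmE !inE.
    by case: (eqVneq v w) => [<-|vw] /=; rewrite ?vA ?(subsetP A0W _ vA).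
  apply: tor_chainZ.
  have := @tor_chain_kelt (A0 :\ v) _ (A0J v vA).
  have A0v : #|A0 :\ v| = i by apply/eqP; rewrite -eqSS -A0i (cardsD1 v A0) vA.
  rewrite A0v mdeg_mesym1 cardsDS ?A0v ?subnKC //.
    by rewrite -A0v subset_leq_card // (subset_trans (subsetDl _ _)).
  exact: subset_trans (subsetDl _ _) A0W.
(* If the cycle were d h with coefficients of h in J, then L would see only faces A, where [cob]
   vanishes; but L of the cycle is [cob A0]. *)
move/(congr1 L); rewrite Ldiff A0W mul1r mcoeffX eqxx mul1r => cobE.
move: cobA0; rewrite cobE [h]kelt_decomp (big_morph _ koszul_diffD koszul_diff0).
rewrite (big_morph L LD L0) big1 ?eqxx // => A _; rewrite Ldiff.
have [Jh h0 _] := ch A.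
have [AW|] := boolP (A \subset W); last by rewrite !mul0r.
have [Ai|Ai] := eqVneq #|A| i.+1; last by rewrite h0 // mcoeff0 mulr0 mul0r.
have [/(cob0 _ AW Ai)->|nE] := pselect (upset E (mesym1 (W :\: A))).
  by rewrite mulr0.
by rewrite (monomial_ideal_mcoeff Jh nE) mulr0 mul0r.
Qed.

End Koszul.

(** * Connected Koszul complexes give linear relations *)

Section LinearRelations.
Local Open Scope ring_scope.
Variables (K : fieldType) (n d : nat) (E : 'X_{1..n} -> Prop).
Local Notation S := {mpoly K[n]}.
Local Notation J := (monomial_ideal (K := K) E).
Hypothesis Edeg : forall m, E m -> mdeg m = d.

(* The 1-skeleton of the upper Koszul complex of J in multidegree a. *)
Definition kvertex (a : 'X_{1..n}) (v : 'I_n) :=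
  (0 < a v)%N /\ upset E (a - U_(v))%MM.

Definition kedge (a : 'X_{1..n}) : rel 'I_n := fun u v =>
  [&& u != v, (U_(u) + U_(v) <= a)%MM & `[< upset E (a - (U_(u) + U_(v)))%MM >]].

Lemma kedgeC a u v : kedge a u v = kedge a v u.
Proof. by rewrite /kedge addmC eq_sym. Qed.

Lemma kconnectC a : connect_sym (kedge a).
Proof. by apply: sym_connect_sym => u v; rewrite kedgeC. Qed.

(** A monomial x^m of J of degree above d is a proper multiple of a generator, so some x_v can be
    divided out inside J; then x^m e_set0 is the boundary of (x^m / x_v) e_v. *)
Lemma betti0_eq0 j : (d < j)%N -> betti J 0 j = Some 0%N.
Proof.
move=> dj; apply/betti_eq0 => f [cf _].
have f1 A : A != set0 -> f A = 0 by have [_ + _] := cf A; rewrite cards_eq0.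
rewrite [f]kelt_decomp; apply: tor_boundary_sum => A _ _.
have [->|/f1->] := eqVneq A set0; last by rewrite kelt0; apply: tor_boundary0.
rewrite kelt_mono; apply: tor_boundary_sum => m mf _.
apply: tor_boundaryZ; have [/monomial_idealP Jf _ degf] := cf set0.
have {degf} mj : mdeg m = j by rewrite -(degf m) ?addn0.
have [e Ee em] := Jf _ mf.
have [v ev] : exists v, (e v < m v)%N.
  apply: contrapT => nv; suff em' : e = m by rewrite -mj -em' Edeg ?ltnn in dj.
  apply/mnmP=> v; apply/eqP; rewrite eqn_leq (mnm_lepP em) /= leqNgt.
  by apply: contra_notN nv => ev; exists v.
have Em : upset E (m - U_(v))%MM.
  exists e => //; apply/mnm_lepP => w; rewrite mnmBE mnm1E.
  by case: eqP => [<-|_]; [lia|rewrite subn0 (mnm_lepP em)].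
have vm : (U_(v) <= m)%MM by rewrite lep1mP; lia.
exists (kelt [set v] 'X_[m - U_(v)]).
  have := tor_chain_kelt K [set v] Em.
  by rewrite cards1 -(mdeg1 v) -mdegD addmC submK // mj mdeg1.
rewrite koszul_diff_keltX big_set1 addmC submK // setDv /ksign.
rewrite (_ : [set u in _ | _] = set0) ?cards0 ?scale1r //.
by apply/setP=> w; rewrite !inE; case: eqP => // ->; rewrite ltnn.
Qed.

Lemma tor_boundary_kedge a u v : kedge a u v ->
  tor_boundary J 1 (mdeg a)
    (kelt [set u] 'X_[a - U_(u)] - kelt [set v] 'X_[a - U_(v)]).
Proof.
move=> /and3P[uv uva /asboolP Ea].
pose h : koszul_mod K n := kelt [set u; v] 'X_[a - (U_(u) + U_(v))].
have ch : tor_chain J 2 (mdeg a) h.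
  have := tor_chain_kelt K [set u; v] Ea.
  rewrite cards2 uv /=; suff -> : mdeg a = (2 + mdeg (a - (U_(u) + U_(v))))%N by [].
  by rewrite -{1}(submK uva) !mdegD !mdeg1 addnC.
have uE : [set u; v] :\ u = [set v].
  by apply/setP=> w; rewrite !inE; case: (eqVneq w u) => // ->; rewrite (negbTE uv).
have vE : [set u; v] :\ v = [set u].
  apply/setP=> w; rewrite !inE; case: (w =P v) => [->|]; last by rewrite orbF.
  by rewrite eq_sym (negbTE uv).
have ks x y : x != y -> ksign [set x; y] x = (y < x)%N.
  move=> xy; rewrite /ksign.
  rewrite (_ : [set w in _ | _] = if (y < x)%N then [set y] else set0).
    by case: ifP; rewrite ?cards1 ?cards0.
  apply/setP=> w; case: ifP => yx; rewrite !inE.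
    case: (eqVneq w y) => [->|_]; first by rewrite orbT yx.
    by case: eqP => // ->; rewrite ltnn.
  case: (eqVneq w y) => [->|_]; first by rewrite yx andbF.
  by case: eqP => // ->; rewrite ltnn.
have XE : (U_(u) + (a - (U_(u) + U_(v))))%MM = (a - U_(v))%MM.
  apply/mnmP=> w; have := mnm_lepP uva w; rewrite !(mnmDE, mnmBE); lia.
have YE : (U_(v) + (a - (U_(u) + U_(v))))%MM = (a - U_(u))%MM.
  apply/mnmP=> w; have := mnm_lepP uva w; rewrite !(mnmDE, mnmBE); lia.
have := koszul_diff_keltX K [set u; v] (a - (U_(u) + U_(v)))%MM.
rewrite big_setU1 ?inE //= big_set1 uE vE XE YE ks // [in ksign _ v]setUC ks 1?eq_sym //.
(* The factor makes the sign of the e_u term +1, whichever of u and v is smaller; the e_v term then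
   has sign -1. *)
rewrite -/h => dh; exists ((-1) ^+ (u < v)%N *: h); first exact: tor_chainZ.
rewrite koszul_diffZ dh scalerDr !scalerA -!exprD addrC.
have : u != v :> nat by [].
by case: ltngtP => // _ _; rewrite ?expr1 ?expr0 ?(expr2, mulrNN, mulr1) !scale1r scaleN1r.
Qed.

Lemma tor_boundary_connect a u v : connect (kedge a) u v ->
  tor_boundary J 1 (mdeg a)
    (kelt [set u] 'X_[a - U_(u)] - kelt [set v] 'X_[a - U_(v)]).
Proof.
move=> /connectP[p]; elim: p u => [|w p IH] u /=.
  by move=> _ ->; rewrite subrr; apply: tor_boundary0.
move=> /andP[/tor_boundary_kedge uw pw] vE.
by rewrite -(subrKA (kelt [set w] 'X_[a - U_(w)])); apply: tor_boundaryD (IH _ pw vE).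
Qed.

Hypothesis Econn : forall a u v, (d.+2 <= mdeg a)%N ->
  kvertex a u -> kvertex a v -> connect (kedge a) u v.

(** In multidegree a, a 1-cycle is a combination of vertices whose coefficients add up to 0. Modulo
    boundaries all vertices equal one base vertex, so the combination vanishes. *)
Lemma betti1_eq0 j : (d < j)%N -> betti J 1 (1 + j) = Some 0%N.
Proof.
move=> dj; apply/betti_eq0 => f [cf df].
(* [T a] is the base vertex chosen in multidegree a, or 0 if the complex has no vertex. *)
pose T a : koszul_mod K n := if [pick u : 'I_n | `[< kvertex a u >]] is Some u
  then kelt [set u] 'X_[a - U_(u)] else 0.
have fE : f = \sum_v kelt [set v] (f [set v]).
  apply/ffunP=> B; rewrite sum_ffunE.
  have [B1|B1] := boolP (#|B| == 1%N); last first.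
    have [_ -> // _] := cf B; rewrite big1 // => v _; rewrite ffunE.
    by case: eqP => // BE; rewrite BE cards1 in B1.
  have [v ->] := cards1P B1; rewrite (bigD1 v) //= ffunE eqxx big1 ?addr0 //.
  by move=> w wv; rewrite ffunE eqEcard !cards1 sub1set inE eq_sym (negbTE wv).
have supp_vertex v m : m \in msupp (f [set v]) ->
    kvertex (m + U_(v))%MM v /\ mdeg (m + U_(v)) = (1 + j)%N.
  move=> mf; have [/monomial_idealP Jf _ /(_ m mf)] := cf [set v].
  rewrite mdegD mdeg1 addnC => ->; split=> //; split; last by rewrite addmK; apply: Jf.
  by rewrite mnmDE mnm1E eqxx addn1.
pose F v m := kelt [set v] 'X_[m] - T (m + U_(v))%MM.
have -> : f = \sum_v \sum_(m <- msupp (f [set v])) (f [set v])@_m *: F v m.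
  (* The linear map that sends x^a to [T a]; all degrees that occur are j + 1, so the bound j + 2
     suffices. Applied to the component of d f at the empty set, it shows that the base vertices
     subtracted in F cancel in total. *)
  pose rho (p : S) := \sum_(a : 'X_{1..n < j.+2}) p@_a *: T a.
  have rhoD p q : rho (p + q) = rho p + rho q.
    by rewrite -big_split; apply: eq_bigr => a _; rewrite mcoeffD scalerDl.
  have rho0 : rho 0 = 0 by rewrite /rho big1 // => a _; rewrite mcoeff0 scale0r.
  have rhoX c a : (mdeg a < j.+2)%N -> rho (c *: 'X_[a]) = c *: T a.
    move=> aj; rewrite /rho (bigD1 (BMultinom aj)) //= mcoeffZ mcoeffX eqxx mulr1.
    rewrite big1 ?addr0 // => b; rewrite bmeqP /= => /negbTE ba.
    by rewrite mcoeffZ mcoeffX eq_sym ba mulr0 scale0r.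
  have rho_f : \sum_v \sum_(m <- msupp (f [set v])) (f [set v])@_m *: T (m + U_(v))%MM = 0.
    transitivity (rho 0) => //; have /ffunP/(_ set0) := df; rewrite !ffunE => <-.
    rewrite (big_morph rho rhoD rho0) [RHS]big_mkcond /=; apply: eq_bigr => v _.
    rewrite inE /= (_ : [set u in _ | _] = set0); last by apply/setP => u; rewrite !inE.
    rewrite cards0 mul1r setU0 [X in _ * X]mpolyE mulr_sumr (big_morph rho rhoD rho0).
    rewrite !big_seq; apply: eq_bigr => m mf.
    by rewrite -scalerAr -mpolyXD (addmC U_(v)%MM) rhoX // (supp_vertex v m mf).2.
  rewrite [LHS]fE -[RHS]addr0 -[X in _ = _ + X]rho_f -big_split /=.
  apply: eq_bigr => v _; rewrite kelt_mono -big_split /=.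
  by apply: eq_bigr => m _; rewrite -scalerDr subrK.
apply: tor_boundary_sum => v _ _; apply: tor_boundary_sum => m /supp_vertex[mv mj] _.
apply: tor_boundaryZ; rewrite /F /T.
case: pickP => [u /asboolP mu|/(_ v)/asboolP//].
have := tor_boundary_connect (Econn (a := (m + U_(v))%MM) _ mv mu).
by rewrite mj addmK; apply.
Qed.

Lemma steps_linear1 : steps_linear J 1.
Proof.
exists d; split; first exact: monomial_ideal_degree.
by case=> [|[|//]] j _ dj; [apply: betti0_eq0|apply: betti1_eq0].
Qed.

End LinearRelations.

(** * Reduction to squarefree multidegrees *)

Section SquarefreeIdeals.
Variables (n d : nat) (E : 'X_{1..n} -> Prop).
Hypothesis Esqf : forall m, E m -> squarefree m.

Lemma mesym1B (W A : {set 'I_n}) : (mesym1 W - mesym1 A)%MM = mesym1 (W :\: A).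
Proof. by apply/mnmP=> v; rewrite mnmBE !mnmE inE; case: (v \in A); case: (v \in W). Qed.

Lemma squarefreeP (m : 'X_{1..n}) : squarefree m -> exists W, m = mesym1 W.
Proof.
move=> /forallP m1; exists [set v | m v != 0]; apply/mnmP=> v.
by rewrite mnmE inE; have := m1 v; case: (m v) => [|[]].
Qed.

Lemma squarefree_mesym1 (W : {set 'I_n}) : squarefree (mesym1 W).
Proof. by apply/forallP=> v; rewrite mnmE leq_b1. Qed.

Lemma lem_mesym1 (A W : {set 'I_n}) : (mesym1 A <= mesym1 W)%MM = (A \subset W).
Proof.
apply/mnm_lepP/subsetP => AW v; have := AW v; rewrite !mnmE.
  by case: (v \in A); case: (v \in W).
by case: (v \in A) => //= ->.
Qed.

Lemma kedge_mesym1 (W : {set 'I_n}) u v : u != v -> u \in W -> v \in W ->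
  upset E (mesym1 (W :\: [set u; v])) -> kedge E (mesym1 W) u v.
Proof.
move=> uv uW vW uvE; have uvm : (U_(u) + U_(v) = mesym1 [set u; v])%MM.
  apply/mnmP=> w; rewrite mnmDE !mnm1E mnmE !inE.
  by rewrite ![w == _]eq_sym; case: (eqVneq u w) uv => [<-|_]; first by case: eqVneq.
rewrite /kedge uv uvm mesym1B lem_mesym1 (asboolT uvE) andbT.
by apply/subsetP=> w; rewrite !inE => /orP[]/eqP->.
Qed.

(* If x_w^2 divides the degree, then w is an apex of the Koszul complex, so only
   squarefree degrees matter. *)
Lemma kconnect_squarefree :
  (forall (W : {set 'I_n}) u v, d < #|W| -> u \in W -> v \in W ->
    upset E (mesym1 (W :\ u)) -> upset E (mesym1 (W :\ v)) ->
    connect (kedge E (mesym1 W)) u v) ->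
  forall a u v, d < mdeg a -> kvertex E a u -> kvertex E a v ->
    connect (kedge E a) u v.
Proof.
move=> Wconn a u v da au av; have [/squarefreeP[W aW]|] := boolP (squarefree a).
  move: da au av; rewrite aW mdeg_mesym1 /kvertex -!mesym1_set1 !mesym1B !mnmE.
  by rewrite !lt0b => da [uW uE] [vW vE]; apply: Wconn.
move=> /forallPn[w]; rewrite -ltnNge => aw.
have to_w x : kvertex E a x -> connect (kedge E a) x w.
  move=> [ax [e Ee ea]]; have [->//|xw] := eqVneq x w.
  apply: connect1; apply/and3P; split=> //.
    apply/mnm_lepP=> y; rewrite mnmDE !mnm1E.
    have [xy|_] := eqVneq x y; have [wy|_] := eqVneq w y; subst=> //; try lia.
  apply/asboolP; exists e => //; apply/mnm_lepP=> y; have := mnm_lepP ea y.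
  rewrite !(mnmBE, mnmDE, mnm1E); have [wy|wy] := eqVneq w y; last by rewrite addn0.
  rewrite -wy (negbTE xw) => _; have /forallP/(_ w) := Esqf Ee; lia.
by apply: connect_trans (to_w _ au) _; rewrite kconnectC; apply: to_w.
Qed.

End SquarefreeIdeals.

(** * The index in terms of linear steps *)

Section Index.
Local Open Scope ring_scope.
Variables (K : fieldType) (n : nat).
Local Notation S := {mpoly K[n]}.
Implicit Types (J : S -> Prop) (E : 'X_{1..n} -> Prop).

Lemma steps_linear_le J r s : (r <= s)%N -> steps_linear J s -> steps_linear J r.
Proof.
move=> rs [d [Jd bd]]; exists d; split=> // i j ir; apply: bd.
exact: leq_trans rs.
Qed.

Lemma lin_index_gt1 J :
  ext_lt 1 (lin_index J) <-> zero_ideal J \/ steps_linear J 1.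
Proof.
rewrite /lin_index; case: asboolP => J0 /=; first by split; auto.
have -> : ext_lt 1 (omap succn (sup_nat (steps_linear J))) =
  ext_lt 0 (sup_nat (steps_linear J)) by case: sup_nat.
rewrite sup_nat_gt; split=> [[r rJ r0]|[//|sJ]]; last by exists 1%N.
by right; apply: steps_linear_le rJ.
Qed.

Lemma lin_index_eq2 J : ~ zero_ideal J -> steps_linear J 1 -> ~ steps_linear J 2 ->
  lin_index J = Some 2%N.
Proof.
rewrite /lin_index; case: asboolP => // _ _ s1 s2.
suff -> : sup_nat (steps_linear J) = Some 1%N by [].
apply/ext_eqP => -[|m]; first by apply/sup_nat_gt; exists 1%N.
apply/negP => /sup_nat_gt[r rJ mr]; apply: s2; apply: steps_linear_le rJ.
by apply: leq_trans mr.
Qed.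

(** The degree in [steps_linear] is existentially quantified. The generator m forces that degree to
    be at most d, so j - i lies above it as well. *)
Lemma not_steps_linear E d m i j r : E m -> mdeg m = d ->
  (i <= r)%N -> (i + d < j)%N ->
  betti (monomial_ideal (K := K) E) i j <> Some 0%N ->
  ~ steps_linear (monomial_ideal (K := K) E) r.
Proof.
move=> Em md ir dj bij [d' [Jd' bd']]; apply: bij.
rewrite -(subnKC (n := j) (m := i)); last by lia.
apply: bd' => //; suff : (d' <= d)%N by lia.
rewrite -md; apply: generated_in_degree_le Jd' _.
exact/monomial_idealX/upset_gen.
Qed.

Lemma monomial_ideal_zero E : zero_ideal (monomial_ideal (K := K) E) <-> forall m, ~ E m.
Proof.
split=> [J0 m Em|E0 p /monomial_idealP pE].
  have /J0/(congr1 (mcoeff m)) : monomial_ideal (K := K) E 'X_[m].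
    exact/monomial_idealX/upset_gen.
  by rewrite mcoeffX eqxx mcoeff0 => /eqP; rewrite oner_eq0.
by apply/mpolyP => m; rewrite mcoeff0; apply: memN_msupp_eq0;
  apply/negP => /pE[e /E0].
Qed.

End Index.

(** * Ordinary and squarefree powers of edge ideals *)

Section EdgeIdealPowers.
Local Open Scope ring_scope.
Variables (K : fieldType) (n : nat) (g : rel 'I_n).
Local Notation S := {mpoly K[n]}.

(** The exponents of products of k edges, repetition allowed. The squarefree ones are the indicators
    of the vertex sets covered by k-matchings. *)
Fixpoint edge_sum (k : nat) (m : 'X_{1..n}) : Prop :=
  if k is k'.+1 then
    exists u v m', [/\ g u v, edge_sum k' m' & m = (U_(u) + U_(v) + m')%MM]
  else m = 0%MM.

Lemma edge_sum_mdeg k m : edge_sum k m -> mdeg m = k.*2.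
Proof.
elim: k m => [|k IH] m /=; first by move->; rewrite mdeg0.
by move=> [u [v [m' [_ /IH m'k ->]]]]; rewrite !mdegD !mdeg1 m'k; lia.
Qed.

Lemma edge_sumD k l m m' : edge_sum k m -> edge_sum l m' -> edge_sum (k + l) (m + m').
Proof.
move=> + ml; elim: k m => [|k IH] m /=; first by move->; rewrite add0m.
move=> [u [v [m'' [uv /IH mk ->]]]]; exists u, v, (m'' + m')%MM.
by rewrite addmA; split.
Qed.

Definition sqf_edge_sum k m : Prop := edge_sum k m /\ squarefree m.

Hypotheses (g_irr : forall u, ~~ g u u) (g_sym : forall u v, g u v = g v u).

Lemma mem_edges u v : ([set u; v] \in edges g) = g u v.
Proof.
apply/idP/idP => [/imsetP[[x y] /= xy uvE]|uv]; last first.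
  by apply/imsetP; exists (u, v); rewrite ?inE.
rewrite inE /= in xy; have xNy : x != y by apply: contraTneq xy => ->; apply: g_irr.
have : u \in [set x; y] by rewrite -uvE set21.
have : v \in [set x; y] by rewrite -uvE set22.
have : x \in [set u; v] by rewrite uvE set21.
have : y \in [set u; v] by rewrite uvE set22.
rewrite !inE; do 4 ![case/orP=> /eqP ?]; subst; rewrite ?eqxx // in xNy *.
all: by rewrite g_sym.
Qed.

Lemma ideal_pow_edge_ideal k :
  ideal_pow (edge_ideal K g) k = monomial_ideal (edge_sum k).
Proof.
elim: k => [|k IH]; apply/predeqP => p /=.
  split=> // _; apply/monomial_idealP => m _.
  by exists 0%MM => //; apply/mnm_lepP=> i; rewrite mnm0E.
rewrite IH; split.
  apply: (@ideal_gen_min _ _ _ (monomial_ideal _)).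
  - exact: ideal_gen0.
  - by move=> u v; apply: ideal_genD.
  move=> c _ [a [b [Ia Ib ->]]]; apply: ideal_genMl; move: Ia.
  apply: (@ideal_gen_min _ _ _ (fun a => monomial_ideal (edge_sum k.+1) (a * b))).
  - by rewrite mul0r; apply: ideal_gen0.
  - by move=> u v; rewrite mulrDl; apply: ideal_genD.
  move=> c' _ [u [v [uv ->]]]; rewrite -mulrA; apply: ideal_genMl.
  move: Ib; apply: (@ideal_gen_min _ _ _
    (fun b => monomial_ideal (edge_sum k.+1) ('X_u * 'X_v * b))).
  - by rewrite mulr0; apply: ideal_gen0.
  - by move=> x y; rewrite mulrDr; apply: ideal_genD.
  move=> c'' _ [m mk ->]; rewrite mulrCA -!mpolyXD; apply: ideal_genM.
  by exists (U_(u) + U_(v) + m)%MM => //; exists u, v, m; rewrite -mem_edges.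
apply: (@ideal_gen_min _ _ _ (ideal_gen _)).
- exact: ideal_gen0.
- by move=> u v; apply: ideal_genD.
move=> c _ [_ [u [v [m [uv mk ->]]]] ->]; apply: ideal_genM.
exists ('X_u * 'X_v), 'X_[m]; rewrite -!mpolyXD; split=> //.
  rewrite mpolyXD -[X in edge_ideal _ _ X]mul1r; apply: ideal_genM.
  by exists u, v; rewrite mem_edges.
exact/monomial_idealX/upset_gen.
Qed.

(** All products of k edges have degree 2k, hence are the minimal generators of the ordinary
    power. *)
Lemma squarefree_power_edge_ideal k :
  squarefree_power (edge_ideal K g) k = monomial_ideal (sqf_edge_sum k).
Proof.
rewrite /squarefree_power ideal_pow_edge_ideal; congr monomial_ideal.
by apply/predeqP => m; rewrite (mingen_homog K (@edge_sum_mdeg k)).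
Qed.

End EdgeIdealPowers.

(** * Which vertex sets of the cycle have a perfect matching *)

Section CycleEdgeSums.
Variable n : nat.
Hypothesis n_gt3 : 3 < n.
Local Notation g := (cycle_graph n).
Implicit Types (u v w x y z : 'I_n) (A : {set 'I_n}).

Lemma cycle_irr u : ~~ g u u.
Proof. rewrite /cycle_graph /=; lia. Qed.

Lemma cycle_sym u v : g u v = g v u.
Proof. rewrite /cycle_graph /=; lia. Qed.

Lemma edge_sum_segment s l : s + l.*2 <= n ->
  edge_sum g l (mesym1 [set v : 'I_n | s <= v < s + l.*2]).
Proof.
elim: l => [|l IH] sl.
  by apply/mnmP=> v; have := ltn_ord v; rewrite mnm0E mnmE inE; lia.
have xP : s + l.*2 < n by lia.
have yP : (s + l.*2).+1 < n by lia.
exists (Ordinal xP), (Ordinal yP), (mesym1 [set v : 'I_n | s <= v < s + l.*2]).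
split; [by rewrite /cycle_graph /= eqxx|by apply: IH; lia|].
by apply/mnmP=> v; have := ltn_ord v; rewrite !mnmDE !mnm1E !mnmE !inE -!val_eqE /=; lia.
Qed.

(** The set is the arc c + 1, ..., n - 1, 0, ..., a - 1. If its two pieces on either side of 0 have
    odd size, the edge {n - 1, 0} is used first and leaves even segments. *)
Lemma edge_sum_outer a c : a <= c < n -> odd a = odd (n.-1 - c) ->
  edge_sum g ((a + (n.-1 - c))./2) (mesym1 [set v : 'I_n | (v < a) || (c < v)]).
Proof.
move=> acn par; have [oa|ea] := boolP (odd a).
  have xP : 0 < n by lia.
  have yP : n.-1 < n by lia.
  have -> : (a + (n.-1 - c))./2 = (a./2 + (n.-1 - c)./2).+1 by lia.
  exists (Ordinal xP), (Ordinal yP), (mesym1 [set v : 'I_n | 1 <= v < 1 + a./2.*2] +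
    mesym1 [set v : 'I_n | c.+1 <= v < c.+1 + (n.-1 - c)./2.*2])%MM.
  split; first by rewrite /cycle_graph /=; lia.
    by apply: edge_sumD; apply: edge_sum_segment; lia.
  by apply/mnmP=> v; have := ltn_ord v; rewrite !mnmDE !mnm1E !mnmE !inE -!val_eqE /=; lia.
have -> : (a + (n.-1 - c))./2 = (a./2 + (n.-1 - c)./2) by lia.
have -> : mesym1 [set v : 'I_n | (v < a) || (c < v)] =
    (mesym1 [set v : 'I_n | 0 <= v < 0 + a./2.*2] +
     mesym1 [set v : 'I_n | c.+1 <= v < c.+1 + (n.-1 - c)./2.*2])%MM.
  by apply/mnmP=> v; have := ltn_ord v; rewrite !mnmDE !mnmE !inE; lia.
by apply: edge_sumD; apply: edge_sum_segment; lia.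
Qed.

(** Removing two vertices of opposite parity from an even cycle leaves two arcs with an even number
    of vertices each. *)
Lemma edge_sum_pair u v : ~~ odd n -> odd (u + v) ->
  edge_sum g (n./2 - 1) (mesym1 (~: [set u; v])).
Proof.
move=> en; wlog uv : u v / u < v => [IH|] ouv.
  have [uv|vu|/val_inj uv] := ltngtP u v; first exact: IH.
    by rewrite setUC; apply: IH; rewrite // addnC.
  by rewrite uv addnn odd_double in ouv.
have := ltn_ord v => vn.
have -> : n./2 - 1 = (u + (n.-1 - v))./2 + (v - u.+1)./2 by lia.
have -> : mesym1 (~: [set u; v]) = (mesym1 [set w : 'I_n | ((w < u) || (v < w))%N] +
    mesym1 [set w : 'I_n | u.+1 <= w < u.+1 + (v - u.+1)./2.*2])%MM.
  by apply/mnmP=> w; have := ltn_ord w; rewrite mnmDE !mnmE !inE -!val_eqE /=; lia.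
apply: edge_sumD; first by apply: edge_sum_outer; lia.
by apply: edge_sum_segment; lia.
Qed.

(* Whether the distance from x to y along the orientation 0, 1, ..., n - 1, 0 is
   odd, when n is odd. *)
Definition odd_arc (x y : nat) := odd (x + y) == (x < y).

Lemma edge_sum_triple x y z : odd n -> x != y -> y != z -> z != x ->
  odd_arc x y -> odd_arc y z -> odd_arc z x ->
  edge_sum g (n./2 - 1) (mesym1 (~: [set x; y; z])).
Proof.
move=> on.
suff H (a b c : 'I_n) : a < b -> b < c -> odd (b - a) -> odd (c - b) ->
    edge_sum g (n./2 - 1) (mesym1 (~: [set a; b; c])).
  rewrite -!val_eqE /odd_arc /= => xy yz zx oxy oyz ozx.
  (* The three oriented distances add up to n or to 2n. Being odd they add up to n, so x, y, z occur
     in cyclic order. *)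
  have [/andP[xLy yLz]|[/andP[yLz zLx]|/andP[zLx xLy]]] :
      (x < y < z) \/ (y < z < x) \/ (z < x < y) by lia.
  - by apply: H => //; lia.
  - suff -> : [set x; y; z] = [set y; z; x] by apply: H => //; lia.
    by rewrite -setUA setUC.
  - suff -> : [set x; y; z] = [set z; x; y] by apply: H => //; lia.
    by rewrite setUC setUA.
move=> ab bc oab obc; have := ltn_ord c => cn.
have -> : n./2 - 1 = (a + (n.-1 - c))./2 + ((b - a.+1)./2 + (c - b.+1)./2) by lia.
have -> : mesym1 (~: [set a; b; c]) = (mesym1 [set w : 'I_n | ((w < a) || (c < w))%N] +
    (mesym1 [set w : 'I_n | a.+1 <= w < a.+1 + (b - a.+1)./2.*2] +
     mesym1 [set w : 'I_n | b.+1 <= w < b.+1 + (c - b.+1)./2.*2]))%MM.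
  by apply/mnmP=> w; have := ltn_ord w; rewrite !mnmDE !mnmE !inE -!val_eqE /=; lia.
apply: edge_sumD; first by apply: edge_sum_outer; lia.
by apply: edge_sumD; apply: edge_sum_segment; lia.
Qed.

(* No edge leaves the open segment between two vertices that are not covered. *)
Lemma edge_sum_even_segment k m (a b : 'I_n) : edge_sum g k m -> a < b ->
  m a = 0 -> m b = 0 -> ~~ odd (\sum_(v : 'I_n | a < v < b) m v).
Proof.
move=> mk ab; elim: k m mk => [|k IH] m.
  by move=> -> _ _; rewrite big1 // => v _; rewrite mnm0E.
move=> [u [v [m' [uv m'k ->]]]]; rewrite !mnmDE !mnm1E => ma mb.
under eq_bigr do rewrite !mnmDE !mnm1E.
rewrite !big_split /= !oddD (negbTE (IH m' m'k _ _)); [|lia|lia].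
have sum1 w : \sum_(v : 'I_n | a < v < b) (w == v) = (a < w < b).
  have [wab|wab] := boolP (a < w < b).
    rewrite (bigD1 w) //= eqxx big1 // => x /andP[_].
    by rewrite eq_sym => /negbTE->.
  by rewrite big1 // => x xab; case: eqP => // wx; rewrite wx xab in wab.
rewrite !sum1 addbF; move: uv ma mb; rewrite /cycle_graph -!val_eqE /=.
have := ltn_ord u; have := ltn_ord v; have := ltn_ord b; lia.
Qed.

(** The b - a - 1 vertices strictly between a and b are matched among themselves, so their number is
    even. *)
Lemma edge_sum_odd_gap k A (a b : 'I_n) : edge_sum g k (mesym1 A) -> a < b ->
  a \notin A -> b \notin A -> (forall v, a < v < b -> v \in A) -> odd (b - a).
Proof.
move=> Ak ab aA bA abA.
have := edge_sum_even_segment Ak ab; rewrite !mnmE (negbTE aA) (negbTE bA).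
move=> /(_ erefl erefl); under eq_bigr => v vab do rewrite mnmE abA //.
rewrite -(big_mkord (fun i => a < i < b) (fun=> 1)).
have := ltn_ord b => bn.
have an : a < n by lia.
rewrite (big_cat_nat (n := a.+1)) // (big_cat_nat (m := a.+1) (n := b)) ?(ltnW bn) //=.
rewrite big_nat_cond big1 ?add0n; last by move=> i; lia.
rewrite [X in _ + X]big_nat_cond [X in _ + X]big1 ?addn0; last by move=> i; lia.
rewrite big_nat_cond (eq_bigl (fun i => (a.+1 <= i < b) && true)); last by move=> i; lia.
rewrite -big_nat_cond sum_nat_const_nat; lia.
Qed.

End CycleEdgeSums.

(** * The matching number and the restricted matching number of a cycle *)

Section CycleMatchings.
Variable n : nat.
Hypothesis n_gt3 : 3 < n.
Local Notation g := (cycle_graph n).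
Implicit Types (u v : 'I_n) (e f : {set 'I_n}) (M : {set {set 'I_n}}).

Lemma cycle_edgeP e : reflect (exists u v, g u v /\ e = [set u; v]) (e \in edges g).
Proof.
apply: (iffP imsetP) => [[[u v]]|[u [v [uv ->]]]]; first by rewrite inE => ? ->; exists u, v.
by exists (u, v); rewrite ?inE.
Qed.

Lemma matching_cover M : matching g M -> #|cover M| = #|M|.*2.
Proof.
move=> /andP[/subsetP ME /eqP <-]; rewrite -muln2 -sum_nat_const.
apply: eq_bigr => e /ME/cycle_edgeP[u [v [uv ->]]]; rewrite cards2.
by case: eqP uv => // ->; rewrite (negbTE (cycle_irr n_gt3 v)).
Qed.

Definition step_edge (p : nat) : {set 'I_n} :=
  [set v : 'I_n | (v == p :> nat) || (v == p.+1 :> nat)].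

Lemma step_edge_in p : p.+1 < n -> step_edge p \in edges g.
Proof.
move=> pn; apply/cycle_edgeP; exists (Ordinal (ltnW pn)), (Ordinal pn).
split; first by rewrite /cycle_graph /= eqxx.
by apply/setP=> v; rewrite !inE -!val_eqE.
Qed.

(** Serves the lower bounds for both matching numbers: edges {p, p + 1} are disjoint once their
    starting points are at least two apart. *)
Lemma step_matching l (p : 'I_l -> nat) (M := [set step_edge (p i) | i : 'I_l]) :
  (forall i, (p i).+1 < n) -> (forall i j : 'I_l, i < j -> (p i).+1 < p j) ->
  matching g M /\ #|M| = l.
Proof.
move=> pn plt.
have pdisj i j : i != j -> [disjoint step_edge (p i) & step_edge (p j)].
  move=> ij; rewrite disjoint_subset; apply/subsetP=> v; rewrite !inE.
  have : i < j \/ j < i by move: ij; rewrite -val_eqE /=; lia.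
  by case=> /plt; lia.
split; last first.
  rewrite card_imset ?card_ord // => i j ij; apply/eqP; apply: contraT => /pdisj.
  rewrite -ij -setI_eq0 setIid => /eqP/setP/(_ (Ordinal (ltnW (pn i)))).
  by rewrite !inE eqxx.
apply/andP; split; first by apply/subsetP=> _ /imsetP[i _ ->]; apply: step_edge_in.
apply/trivIsetP=> _ _ /imsetP[i _ ->] /imsetP[j _ ->] ij; apply: pdisj.
by apply: contraNneq ij => ->.
Qed.

Lemma matching_number_cycle : matching_number g = n./2.
Proof.
apply/eqP; rewrite eqn_leq; apply/andP; split.
  apply/bigmax_leqP => M /matching_cover Mc.
  have := max_card (mem (cover M)); rewrite card_ord Mc; lia.
have [|i j|mM cM] := @step_matching n./2 (fun i => i.*2).
- by move=> i; have := ltn_ord i; lia.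
- by lia.
by rewrite -[X in X <= _]cM; apply: (leq_bigmax_cond (F := fun M => #|M|)).
Qed.

Lemma next_vertex u : exists v : 'I_n, v = (if u.+1 == n then 0 else u.+1) :> nat.
Proof.
case: (eqVneq u.+1 n) => un; first by exists (Ordinal (ltnW (ltnW (ltnW n_gt3)))).
have un' : u.+1 < n by have := ltn_ord u; lia.
by exists (Ordinal un').
Qed.

Lemma prev_vertex u : exists v : 'I_n, v = (if u == 0 :> nat then n.-1 else u.-1) :> nat.
Proof.
have nn : n.-1 < n by lia.
case: (eqVneq (val u) 0) => u0; first by exists (Ordinal nn).
have un' : u.-1 < n by have := ltn_ord u; lia.
by exists (Ordinal un').
Qed.

(** The outer neighbours of an edge are distinct because n > 3; in a triangle they coincide. *)
Lemma cycle_edge_neighbours u v : g u v ->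
  exists x y, [/\ x != y, x \notin [set u; v], y \notin [set u; v], g x u & g y v].
Proof.
have key (a b : 'I_n) : (b = (if a.+1 == n then 0 else a.+1) :> nat) ->
  exists x y, [/\ x != y, x \notin [set a; b], y \notin [set a; b], g x a & g y b].
  move=> bE; have [y yE] := next_vertex b; have [x xE] := prev_vertex a.
  exists x, y; rewrite !inE -!val_eqE /cycle_graph.
  move: bE xE yE; have := ltn_ord a; have := ltn_ord b => /=.
  by do 3![case: eqP]; split; lia.
move=> uv; have : (val v = if u.+1 == n then 0 else u.+1) \/
    (val u = if v.+1 == n then 0 else v.+1).
  move: uv; rewrite /cycle_graph /=; have := ltn_ord u; have := ltn_ord v.
  by case: (eqVneq u.+1 n) => ?; case: (eqVneq v.+1 n) => ?; lia.
case=> /key // [x [y [xy xvu yvu gxv gyu]]]; exists y, x.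
by rewrite eq_sym setUC.
Qed.

Lemma gap_neighbour e e' x u :
  gap g e e' -> u \in e -> g x u -> x \notin e'.
Proof.
move=> /andP[_ /existsP eNe'] ue xu; apply/negP=> xe'; apply: eNe'.
exists [set x; u]; apply/and3P; split; first by apply/cycle_edgeP; exists x, u.
  by apply/set0Pn; exists u; rewrite !inE ue eqxx orbT.
by apply/set0Pn; exists x; rewrite !inE xe' eqxx.
Qed.

(** The two outer neighbours of the distinguished edge e stay uncovered, since a matching edge
    through one of them forms no gap with e. Hence 2 #|M| <= n - 2. *)
Lemma restricted_matching_le M : restricted_matching g M -> #|M| <= n./2 - 1.
Proof.
move=> /andP[mM /existsP[e /andP[eM /forallP eP]]].
have gapM e' : e' \in M -> e' != e -> gap g e e'.
  by move=> e'M e'e; have := eP e'; rewrite e'M e'e.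
have /andP[/subsetP ME _] := mM; have /cycle_edgeP[u [v [uv eE]]] := ME e eM.
have [x [y [xy xe ye xu yv]]] := cycle_edge_neighbours uv.
have notin z w : z \notin e -> w \in e -> g z w -> z \notin cover M.
  move=> ze we zw; apply/bigcupP => -[e' e'M ze'].
  have [e'e|/(gapM e' e'M) gape] := eqVneq e' e; first by rewrite -e'e ze' in ze.
  by have := gap_neighbour gape we zw; rewrite ze'.
have : cover M \subset ~: [set x; y].
  apply/subsetP=> z; apply: contraTT; rewrite !inE negbK => /orP[]/eqP->.
    by apply: notin xu; rewrite eE // set21.
  by apply: notin yv; rewrite eE // set22.
move/subset_leq_card; rewrite matching_cover // [X in _ <= X]cardsCs setCK card_ord cards2 xy; lia.
Qed.

Lemma restricted_matching_number_cycle : restricted_matching_number g = n./2 - 1.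
Proof.
(* The edges {0, 1}, {3, 4}, {5, 6}, ...: the vertices 2 and n - 1 stay uncovered, so {0, 1} forms a
   gap with all the others. *)
pose p (i : 'I_(n./2 - 1)) := i.*2 + (0 < i).
have [|i j|mM cM] := @step_matching _ p.
- by move=> i; have := ltn_ord i; rewrite /p; lia.
- by rewrite /p; lia.
set M := [set _ | i in _] in mM cM.
have rM : restricted_matching g M.
  have m0 : 0 < n./2 - 1 by lia.
  rewrite /restricted_matching mM; apply/existsP.
  exists (step_edge (p (Ordinal m0))); rewrite imset_f //=.
  apply/forallP => e'; apply/implyP => /imsetP[i _ ->]; apply/implyP => ie.
  have i0 : 0 < i by rewrite lt0n; apply: contraNneq ie => i0; rewrite /p i0.
  have in_ := ltn_ord i.
  rewrite /gap /p /= i0; apply/andP; split.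
    by rewrite disjoint_subset; apply/subsetP=> v; rewrite !inE; lia.
  apply/existsP => -[f /and3P[/cycle_edgeP[u [v [uv ->]]]]].
  move=> /set0Pn[x]; rewrite !inE => /andP[xe xuv] /set0Pn[y].
  rewrite !inE -!val_eqE /= => /andP[ye yuv]; move: uv xuv; rewrite -!val_eqE /cycle_graph /=.
  lia.
rewrite /restricted_matching_number ifT; last by apply/existsP; exists M.
apply/eqP; rewrite eqn_leq; apply/andP; split.
  by apply/bigmax_leqP => N; apply: restricted_matching_le.
by rewrite -[X in X <= _]cM; apply: (leq_bigmax_cond (F := fun M => #|M|)).
Qed.

End CycleMatchings.

(** * The simplicial coboundary on pairs and triples, with explicit signs *)

Section Coboundaries.
Local Open Scope ring_scope.
Variables (K : fieldType) (n : nat).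
Implicit Types (x y z : 'I_n) (A : {set 'I_n}) (psi : {set 'I_n} -> K).

Lemma sorted_pair A : #|A| = 2%N -> exists x y, (x < y)%N /\ A = [set x; y].
Proof.
move=> /eqP/cards2P[x [y [xy ->]]].
have [xLy|yLx|/val_inj xE] := ltngtP x y; [by exists x, y| |by rewrite xE eqxx in xy].
by exists y, x; rewrite setUC.
Qed.

Lemma sorted_triple A : #|A| = 3%N ->
  exists x y z, [/\ (x < y)%N, (y < z)%N & A = [set x; y; z]].
Proof.
move=> A3; have /card_gt0P[x xA] : (0 < #|A|)%N by rewrite A3.
have [|y [z [yz AE]]] := @sorted_pair (A :\ x).
  by apply/eqP; rewrite -eqSS -A3 (cardsD1 x A) xA.
have AE' : A = x |: [set y; z] by rewrite -AE setD1K.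
have : x \notin [set y; z] by rewrite -AE setD11.
rewrite !inE negb_or -!val_eqE /= => /andP[xy xz].
have [xLy|[/andP[yLx xLz]|zLx]] : (x < y \/ y < x < z \/ z < x)%N by lia.
- by exists x, y, z; rewrite AE' setUA.
- by exists y, x, z; rewrite AE' setUA [[set x] :|: _]setUC.
- by exists y, z, x; rewrite AE' setUC.
Qed.

Lemma ksign_min A x : (forall w, w \in A -> x <= w)%N -> ksign A x = 0%N.
Proof.
move=> xmin; apply/eqP; rewrite cards_eq0; apply/eqP/setP=> w; rewrite !inE.
by apply/negP=> /andP[/xmin]; rewrite leqNgt => /negbTE->.
Qed.

Lemma ksignU1 A x v : x \notin A -> ksign (x |: A) v = ((x < v) + ksign A v)%N.
Proof.
move=> xA; rewrite /ksign; have [xv|xv] := boolP (x < v)%N.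
  rewrite (_ : [set w in x |: A | _] = x |: [set w in A | (w < v)%N]).
    by rewrite cardsU1 !inE (negbTE xA).
  by apply/setP=> w; rewrite !inE; case: eqP => // ->.
apply: eq_card => w; rewrite !inE.
by case: eqP => // ->; rewrite (negbTE xA) (negbTE xv).
Qed.

Lemma ksign1 x v : ksign [set x] v = (x < v)%N.
Proof.
rewrite -[[set x]]setU0 ksignU1 ?inE // (_ : ksign set0 v = 0%N) ?addn0 //.
by apply: ksign_min => w; rewrite inE.
Qed.

Lemma coboundary_pair psi x y : (x < y)%N ->
  \sum_(v in [set x; y]) (-1) ^+ ksign [set x; y] v * psi ([set x; y] :\ v) =
  psi [set y] - psi [set x].
Proof.
move=> xy; have xNy : x != y by rewrite -val_eqE /= (ltn_eqF xy).
have yNx : y != x by rewrite eq_sym.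
rewrite big_setU1 ?inE //= big_set1 !ksignU1 ?inE // !ksign1 !ltnn.
rewrite xy ltnNge (ltnW xy) /= expr0 expr1 mul1r mulN1r.
congr (psi _ - psi _); apply/setP=> w; rewrite !inE.
  by case: (w =P x) => [->|//]; rewrite (negbTE xNy).
by case: (w =P y) => [->|]; rewrite ?orbF ?(negbTE yNx).
Qed.

Lemma coboundary_triple psi x y z : (x < y)%N -> (y < z)%N ->
  \sum_(v in [set x; y; z]) (-1) ^+ ksign [set x; y; z] v * psi ([set x; y; z] :\ v) =
  psi [set y; z] - psi [set x; z] + psi [set x; y].
Proof.
move=> xy yz; have xz := ltn_trans xy yz.
have N (u v : 'I_n) : (u < v)%N ->
    (((u == v) = false) * ((v == u) = false) * ((v < u)%N = false))%type.
  by move=> uv; rewrite -!val_eqE /= (ltn_eqF uv) (gtn_eqF uv) ltnNge (ltnW uv).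
have {N} E := (N _ _ xy, N _ _ yz, N _ _ xz).
rewrite -setUA big_setU1 ?inE ?E //= big_setU1 ?inE ?E //= big_set1.
rewrite !ksignU1 ?inE ?E // !ksign1 !ltnn xy xz yz !E /=.
rewrite expr0 expr1 expr2 mulrNN !mul1r mulN1r addrA.
congr (psi _ - psi _ + psi _); apply/setP=> w; rewrite !inE.
all: case: (w =P x) => [->|_]; [by rewrite ?eqxx ?E|].
all: case: (w =P y) => [->|_]; [by rewrite ?eqxx ?E|].
all: by case: (w == z).
Qed.

End Coboundaries.

(** * Connectedness and cocycles of the Koszul complexes for the cycle *)

Section CycleIndex.
Variables (K : fieldType) (n : nat).
Hypothesis n_gt3 : 3 < n.
Local Notation g := (cycle_graph n).
Local Notation J k := (monomial_ideal (K := K) (sqf_edge_sum g k)).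
Implicit Types (u v w x y z : 'I_n) (A B W : {set 'I_n}).

Lemma sqf_edge_sum_mdeg k m : sqf_edge_sum g k m -> mdeg m = k.*2.
Proof. by case=> /edge_sum_mdeg. Qed.

Lemma sqf_edge_sum_upset k A B : edge_sum g k (mesym1 A) -> A \subset B ->
  upset (sqf_edge_sum g k) (mesym1 B).
Proof.
move=> Ak AB; exists (mesym1 A); last by rewrite lem_mesym1.
by split=> //; apply: squarefree_mesym1.
Qed.

Lemma upset_card k A : upset (sqf_edge_sum g k) (mesym1 A) -> #|A| = k.*2 ->
  edge_sum g k (mesym1 A).
Proof.
move=> [e ek eA] Ak; rewrite -(lem_mdeg_eq eA) ?mdeg_mesym1 ?(sqf_edge_sum_mdeg ek) //.
by case: ek.
Qed.

Lemma edge_sumU k l A B : [disjoint A & B] -> edge_sum g k (mesym1 A) ->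
  edge_sum g l (mesym1 B) -> edge_sum g (k + l) (mesym1 (A :|: B)).
Proof.
move=> AB Ak Bl; suff -> : mesym1 (A :|: B) = (mesym1 A + mesym1 B)%MM by apply: edge_sumD.
apply/mnmP=> v; rewrite mnmDE !mnmE inE.
by case: (boolP (v \in A)) => [/(disjointFr AB)->|].
Qed.

Lemma not_steps_linear_lt k : 0 < k -> k < n./2 - 1 -> ~ steps_linear (J k) 1.
Proof.
move=> k0 kn.
have seg := @edge_sum_segment n n_gt3.
have x1P : 1 < n by lia.
have x2P : 2 < n by lia.
have x3P : 3 < n by lia.
have x4P : 4 < n by lia.
pose x0 : 'I_n := Ordinal (ltnW x1P); pose x1 := Ordinal x1P.
pose x2 := Ordinal x2P; pose x3 := Ordinal x3P; pose x4 := Ordinal x4P.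
(* The edge {1, 2} and the path 4, ..., 2k + 3. The bound on k gives 2k + 4 <= n, and the vertices 0
   and 3 separate the two parts. *)
pose W := [set v : 'I_n | 1 <= v < 1 + 1.*2] :|: [set v : 'I_n | 4 <= v < 4 + k.*2].
have W_card : #|W| = k.+1.*2.
  rewrite -mdeg_mesym1 -[k.+1]add1n; apply: edge_sum_mdeg.
  apply: edge_sumU; first by rewrite disjoint_subset; apply/subsetP=> v; rewrite !inE; lia.
    by apply: seg; lia.
  by apply: seg; lia.
apply: (@not_steps_linear K n _ k.*2 (mesym1 [set v : 'I_n | 4 <= v < 4 + k.*2]) 1 #|W|) => //.
- by split; [apply: seg; lia|apply: squarefree_mesym1].
- by apply: (@edge_sum_mdeg _ g); apply: seg; lia.
- by rewrite W_card; lia.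
(* On single vertices of W, psi is the indicator of the part {1, 2}; the pair {1, 4} meets both
   parts. *)
pose psi B : K := ((B \subset [set v : 'I_n | (v < 3)%N])%:R)%R.
apply: (@betti_neq0 K n _ W [set x1; x4] 1 psi).
- by apply/subsetP=> v; rewrite !inE -!val_eqE /=; lia.
- by rewrite cards2.
- move=> v; rewrite !inE => /orP[]/eqP->.
    apply: (@sqf_edge_sum_upset _
      ([set v : 'I_n | 1 <= v < 1 + 1.*2] :|: [set v : 'I_n | 5 <= v < 5 + (k - 1).*2])).
      rewrite -[k in edge_sum g k](subnKC k0); apply: edge_sumU; try by apply: seg; lia.
      by rewrite disjoint_subset; apply/subsetP=> v'; rewrite !inE; lia.
    by apply/subsetP=> w; rewrite !inE -!val_eqE /=; lia.
  apply: (@sqf_edge_sum_upset _ [set v : 'I_n | 4 <= v < 4 + k.*2]).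
    by apply: seg; lia.
  by apply/subsetP=> w; rewrite !inE -!val_eqE /=; lia.
- move=> A AW /sorted_pair[x [y [xy AE]]] Aup.
  rewrite /= AE coboundary_pair // /psi !sub1set !inE.
  have WA : edge_sum g k (mesym1 (W :\: A)).
    apply: upset_card Aup _; rewrite cardsDS // W_card AE cards2 -val_eqE /=; lia.
  have xW : x \in W by rewrite (subsetP AW) // AE set21.
  have yW : y \in W by rewrite (subsetP AW) // AE set22.
  have xyA v : (v \in A) = (v == x :> nat) || (v == y :> nat) by rewrite AE !inE -!val_eqE.
  have [x3'|x3'] := boolP (x < 3); have [y3|y3] := boolP (y < 3); rewrite ?subrr //; last by lia.
  (* A face {x, y} meeting both parts would leave 2 alone between 1 and 3, or 1 alone between 0 and
     2; neither can be matched. *)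
  have [xE|xE] : x = 1 :> nat \/ x = 2 :> nat by move: xW; rewrite !inE; lia.
    have : odd (x3 - x1).
      by apply: (edge_sum_odd_gap n_gt3 WA) => // [||v]; rewrite !inE ?xyA /=; lia.
    by [].
  have : odd (x2 - x0).
    by apply: (edge_sum_odd_gap n_gt3 WA) => // [||v]; rewrite !inE ?xyA /=; lia.
  by [].
by rewrite /= coboundary_pair // /psi !sub1set !inE /= sub0r oppr_eq0 oner_eq0.
Qed.

(** The two arcs between x and y have total length n, so one of them is odd, from x to y say. With z
    following y, all three arcs of the triple are odd, so every pair extends to a triangle. *)
Lemma upset_odd_pair x y : odd n -> x != y ->
  upset (sqf_edge_sum g (n./2 - 1)) (mesym1 (~: [set x; y])).
Proof.
move=> on xy; suff [z zxy] : exists z, edge_sum g (n./2 - 1) (mesym1 (~: [set x; y; z])).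
  by apply: sqf_edge_sum_upset zxy _; rewrite setCS subsetUl.
wlog xLy : x y xy / odd_arc x y => [H|].
  have [|yx] := boolP (odd_arc x y); first exact: H.
  have [||z zyx] := H y x; first by rewrite eq_sym.
    by move: xy yx; rewrite -val_eqE /odd_arc /=; lia.
  by exists z; rewrite [[set x; y]]setUC.
have [z zE] := next_vertex n_gt3 y; exists z.
have xn := ltn_ord x; have yn := ltn_ord y.
apply: (edge_sum_triple n_gt3) => //; move: xy xLy zE; rewrite /odd_arc -!val_eqE /=;
  case: (eqVneq y.+1 n) => ?; lia.
Qed.

Lemma not_steps_linear_odd : odd n -> ~ steps_linear (J (n./2 - 1)) 2.
Proof.
move=> on.
have x1P : 1 < n by lia.
have x3P : 3 < n by lia.
pose x0 : 'I_n := Ordinal (ltnW x1P); pose x1 := Ordinal x1P.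
pose x3 := Ordinal x3P.
have [e ek _] : upset (sqf_edge_sum g (n./2 - 1)) (mesym1 (~: [set x0; x1])).
  exact: upset_odd_pair.
apply: (@not_steps_linear K n _ _ e 2 #|[set: 'I_n]|) => //.
  by rewrite cardsT card_ord (sqf_edge_sum_mdeg ek); lia.
pose psi (B : {set 'I_n}) : K :=
  (~~ [exists x in B, exists y in B, [&& x < y, ~~ odd x & odd y]])%N%:R%R.
have psiE x y : x < y -> psi [set x; y] = (odd x || ~~ odd y)%:R%R.
  move=> xy; rewrite /psi.
  suff -> : [exists u in [set x; y], exists v in [set x; y], [&& u < v, ~~ odd u & odd v]] =
    ~~ odd x && odd y by rewrite negb_and negbK.
  apply/existsP/idP => [[u /andP[uB /existsP[v /and4P[vB uv ou ov]]]]|/andP[ex oy]].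
    have -> : x = u by apply/val_inj; move: uB vB; rewrite !inE -!val_eqE /=; lia.
    have -> : y = v by apply/val_inj; move: uB vB; rewrite !inE -!val_eqE /=; lia.
    by rewrite ou ov.
  by exists x; rewrite set21; apply/existsP; exists y; rewrite set22 xy ex oy.
have A0_card : #|[set x0; x1; x3]| = 3 by rewrite -setUA cardsU1 cards2 !inE.
apply: (@betti_neq0 K n _ [set: 'I_n] [set x0; x1; x3] 2 psi) => /=.
- exact: subsetT.
- exact: A0_card.
- move=> v vA; rewrite setTD; have [|x [y [xy ->]]] := @sorted_pair n ([set x0; x1; x3] :\ v).
    by move: A0_card; rewrite (cardsD1 v) vA => -[].
  by apply: upset_odd_pair; rewrite // -val_eqE /= (ltn_eqF xy).
- move=> A _ A3; rewrite setTD => Aup.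
  have [x [y [z [xy yz AE]]]] := sorted_triple A3.
  have Ak : edge_sum g (n./2 - 1) (mesym1 (~: A)).
    by apply: upset_card Aup _; rewrite cardsCs setCK card_ord A3; lia.
  rewrite AE coboundary_triple // !psiE //; last exact: ltn_trans yz.
  have inA v : (v \in ~: A) = [&& v != x :> nat, v != y :> nat & v != z :> nat].
    by rewrite AE !inE -!val_eqE /= !negb_or andbA.
  have oxy : odd (y - x).
    by apply: (edge_sum_odd_gap n_gt3 Ak) => // [||v]; rewrite inA; lia.
  have oyz : odd (z - y).
    by apply: (edge_sum_odd_gap n_gt3 Ak) => // [||v]; rewrite inA; lia.
  (* Parities alternate along x, y, z. So psi is 1 on {x, z} and on exactly one of {x, y} and {y,
     z}, and these two contributions cancel. *)
  have -> : odd y = ~~ odd x by lia.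
  have -> : odd z = odd x by lia.
  by case: (odd x); rewrite /= ?subr0 ?subrr ?add0r ?sub0r ?addNr.
rewrite coboundary_triple // !psiE //=.
by rewrite subr0 addr0 oner_eq0.
Qed.

Lemma kconnect_even W u v : ~~ odd n -> (n./2 - 1).*2.+1 < #|W| ->
  u \in W -> v \in W ->
  connect (kedge (sqf_edge_sum g (n./2 - 1)) (mesym1 W)) u v.
Proof.
move=> en Wn _ _.
have -> : W = [set: 'I_n].
  by apply/eqP; rewrite eqEcard subsetT cardsT card_ord; lia.
have edge x y : odd (x + y) -> kedge (sqf_edge_sum g (n./2 - 1)) (mesym1 [set: 'I_n]) x y.
  move=> xy; apply: kedge_mesym1; rewrite ?inE //.
    by apply: contraTneq xy => ->; rewrite addnn odd_double.
  by rewrite setTD; apply: sqf_edge_sum_upset (edge_sum_pair n_gt3 en xy) _.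
have x1P : 1 < n by lia.
pose x0 : 'I_n := Ordinal (ltnW x1P); pose x1 := Ordinal x1P.
(* The complex contains the complete bipartite graph between odd and even vertices: an odd vertex is
   joined to 0, an even one reaches 0 through 1. *)
have to0 w : connect (kedge (sqf_edge_sum g (n./2 - 1)) (mesym1 [set: 'I_n])) w x0.
  have [ow|ew] := boolP (odd w); first by apply/connect1/edge; rewrite addn0.
  apply: (connect_trans (y := x1)); apply/connect1/edge => //=; lia.
by apply: (connect_trans (to0 u)); rewrite kconnectC.
Qed.

Lemma kconnect_odd W u v : odd n -> (n./2 - 1).*2.+1 < #|W| ->
  u \in W -> v \in W ->
  connect (kedge (sqf_edge_sum g (n./2 - 1)) (mesym1 W)) u v.
Proof.
move=> on Wn uW vW; have [->//|uv] := eqVneq u v.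
(* Here #|W| >= n - 1. In the full degree any two vertices are joined; otherwise W misses exactly
   one vertex w. *)
have [WT|/set0Pn[w]] := eqVneq (~: W) set0.
  apply/connect1/kedge_mesym1 => //.
  by rewrite -[W]setCK WT setC0 setTD; apply: upset_odd_pair.
rewrite inE => wW.
have WE : W = ~: [set w].
  apply/eqP; rewrite eqEcard; apply/andP; split.
    by apply/subsetP=> x; rewrite !inE; apply: contraTneq => ->.
  by rewrite cardsCs setCK card_ord cards1; lia.
(* Since W already omits w, a pair {x, y} is an edge as soon as {w, x, y} is a triangle in the full
   degree. *)
have edge x y : x != y -> x != w -> y != w -> odd_arc w x -> odd_arc x y -> odd_arc y w ->
    kedge (sqf_edge_sum g (n./2 - 1)) (mesym1 W) x y.
  move=> xy xw yw wx oxy oyw; apply: kedge_mesym1; rewrite ?WE ?inE //.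
  rewrite setDE -setCU setUA; apply: sqf_edge_sum_upset (subxx _).
  by apply: (edge_sum_triple n_gt3) => //; rewrite eq_sym.
have [r rE] := next_vertex n_gt3 w; have [s sE] := prev_vertex n_gt3 w.
have := ltn_ord w => wn.
have rw : r != w by rewrite -val_eqE /=; move: rE; case: (eqVneq w.+1 n) => ?; lia.
have sw : s != w by rewrite -val_eqE /=; move: sE; case: (eqVneq (val w) 0) => /= ?; lia.
have rs : kedge (sqf_edge_sum g (n./2 - 1)) (mesym1 W) r s.
  apply: edge => //; move: rE sE; rewrite /odd_arc -?val_eqE /=;
    case: (eqVneq w.+1 n) => ?; case: (eqVneq (w : nat) 0) => ?; lia.
have to_r x : x \in W -> connect (kedge (sqf_edge_sum g (n./2 - 1)) (mesym1 W)) x r.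
  rewrite WE !inE -WE => xw; have xn := ltn_ord x.
  have [->//|xr] := eqVneq x r.
  (* If the arc from w to x is even, then x is joined to r, the successor of w; if it is odd, x is
     joined to s, the predecessor, which is joined to r. *)
  have [wx|wx] := boolP (odd_arc w x); last first.
    apply: connect1; rewrite kedgeC; apply: edge => //; rewrite 1?eq_sym //;
      move: xw xr wx rE; rewrite /odd_arc -!val_eqE /=; case: (eqVneq w.+1 n) => ?; lia.
  apply: (connect_trans (y := s)); last by rewrite kconnectC; apply: connect1.
  apply: connect1; apply: edge => //;
    move: xw xr wx sE; rewrite /odd_arc -!val_eqE /=; case: (eqVneq (w : nat) 0) => ?; lia.
by apply: (connect_trans (to_r u uW)); rewrite kconnectC; apply: to_r.
Qed.

Lemma steps_linear_cycle k : n./2 - 1 <= k -> k <= n./2 -> steps_linear (J k) 1.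
Proof.
move=> nk kn; apply: (steps_linear1 K (@sqf_edge_sum_mdeg k)).
apply: kconnect_squarefree => [m []//|W u v Wk uW vW _ _].
have Wn : #|W| <= n by rewrite -[n in _ <= n]card_ord max_card.
(* The case k = n / 2 is excluded by 2k + 2 <= #|W| <= n. *)
have kE : k = n./2 - 1 by lia.
by rewrite kE in Wk *; have [on|en] := boolP (odd n); [apply: kconnect_odd|apply: kconnect_even].
Qed.

End CycleIndex.

(** * Tools for linear quotients: initial segments of a sorted list, and colon ideals *)

Lemma mem_take_sorted (T : eqType) (x0 : T) (key : T -> nat) (s : seq T) i x :
  sorted (fun a b => key a < key b) s -> i < size s ->
  (x \in take i s) = (x \in s) && (key x < key (nth x0 s i)).
Proof.
move=> ss si; have tr : transitive (fun a b : T => key a < key b).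
  by move=> b a c; apply: ltn_trans.
have mono := sorted_ltn_nth tr x0 ss.
have [xs|xs] := boolP (x \in s); last by apply: contraNF xs => /mem_take.
have xi : index x s < size s by rewrite index_mem.
rewrite in_take //=; rewrite -{2}(nth_index x0 xs).
case: ltngtP => [ix|xgt|->]; last by rewrite ltnn.
  by rewrite mono.
by apply/esym/negbTE; rewrite -leqNgt ltnW // mono.
Qed.

Section Colon.
Local Open Scope ring_scope.
Variables (K : fieldType) (n : nat).
Implicit Types (E : 'X_{1..n} -> Prop) (u m : 'X_{1..n}).

(** If x^m lies in the colon ideal, some e in E divides u + m. At a variable v where e exceeds u,
    x_v must divide x^m, and x_v is itself in the colon ideal. *)
Lemma colon_variables E u :
  (forall e, E e -> exists2 v : 'I_n, (u v < e v)%N & upset E (U_(v) + u)%MM) ->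
  generated_by_variables (colon (monomial_ideal (K := K) E) 'X_[u]).
Proof.
move=> Eu; exists [set v | `[< upset E (U_(v) + u)%MM >]].
apply/predeqP => p; split=> [pu|].
  rewrite [p]mpolyE; apply: ideal_gen_sum => m mp _.
  have [e Ee em] : upset E (u + m)%MM.
    by apply: (proj1 (monomial_idealP _ _) pu); rewrite (perm_mem (msuppMX _ _)) map_f.
  have [v uv Ev] := Eu e Ee.
  have vm : (U_(v) <= m)%MM.
    by rewrite lep1mP; have := mnm_lepP em v; rewrite mnmDE; lia.
  rewrite -(submK vm) mpolyXD scalerAl; apply: ideal_genM; exists v => //.
  by rewrite inE; apply/asboolP.
apply: ideal_gen_min; rewrite /colon.
- by rewrite mul0r; apply: ideal_gen0.
- by move=> a b; rewrite mulrDl; apply: ideal_genD.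
move=> c _ [v + ->]; rewrite inE => /asboolP Ev.
by rewrite -mulrA -mpolyXD; apply: ideal_genMl; apply/monomial_idealX.
Qed.

End Colon.

(** * Linear quotients for even cycles *)

Section EvenCycle.
Variables (K : fieldType) (n : nat).
Hypotheses (n_gt3 : 3 < n) (n_even : ~~ odd n).
Local Notation g := (cycle_graph n).

Let pairs : {set 'I_n * 'I_n} := [set p : 'I_n * 'I_n | ~~ odd p.1 & odd p.2].
(** Lexicographic order on pairs, encoded in base n. *)
Let key (p : 'I_n * 'I_n) : nat := p.1 * n + p.2.
Let gen (p : 'I_n * 'I_n) : 'X_{1..n} := mesym1 (~: [set p.1; p.2]).

Let key_lt p q : (key p < key q) = (p.1 < q.1) || ((p.1 == q.1) && (p.2 < q.2)).
Proof. rewrite /key -val_eqE /=; have := ltn_ord p.2; have := ltn_ord q.2; nia. Qed.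

Let pair_eq (p q : 'I_n * 'I_n) : p.1 = q.1 :> nat -> p.2 = q.2 :> nat -> p = q.
Proof. by case: p q => [a b] [c d] /= /val_inj-> /val_inj->. Qed.

Let gen_inj : {in pairs &, injective gen}.
Proof.
move=> p q; rewrite !inE => /andP[p1 p2] /andP[q1 q2] /inj_mesym1/setC_inj pq.
have := set21 p.1 p.2; have := set22 p.1 p.2; rewrite pq !inE -!val_eqE /= => ? ?.
by apply: pair_eq; lia.
Qed.

(** A generator omits exactly two vertices. The segment strictly between them is covered, so their
    distance is odd, and one of them is even and the other odd. *)
Let genE m : sqf_edge_sum g (n./2 - 1) m <-> exists2 p, p \in pairs & m = gen p.
Proof.
split=> [[mk /squarefreeP[W mW]]|[p]]; last first.
  rewrite inE => /andP[p1 p2] ->; split; last exact: squarefree_mesym1.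
  by apply: edge_sum_pair => //; lia.
rewrite mW in mk *; have WC : #|~: W| = 2.
  have := edge_sum_mdeg mk; have := cardsC W; rewrite mdeg_mesym1 card_ord; lia.
have [x [y [xy WE]]] := sorted_pair WC.
have inW v : (v \in W) = (v != x :> nat) && (v != y :> nat).
  by rewrite -[W]setCK WE !inE -!val_eqE /= negb_or.
have oxy : odd (y - x).
  by apply: (edge_sum_odd_gap n_gt3 mk) => // [||v]; rewrite inW; lia.
rewrite -[W]setCK WE; have [ox|ex] := boolP (odd x).
  by exists (y, x); rewrite ?inE /gen /= 1?setUC //; lia.
by exists (x, y); rewrite ?inE /gen //=; lia.
Qed.

Lemma linear_quotients_even :
  linear_quotients (monomial_ideal (K := K) (sqf_edge_sum g (n./2 - 1))).
Proof.
pose L := sort (fun p q => key p <= key q) (enum pairs).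
have LE p : (p \in L) = (p \in pairs) by rewrite mem_sort mem_enum.
have Lu : uniq L by rewrite sort_uniq enum_uniq.
have key_inj : injective key.
  move=> p q pq; have := key_lt p q; have := key_lt q p; rewrite pq ltnn.
  by rewrite -!val_eqE /= => ? ?; apply: pair_eq; lia.
have Ls : sorted (fun p q => key p < key q) L.
  suff : sorted ltn (map key L) by rewrite sorted_map.
  rewrite ltn_sorted_uniq_leq map_inj_uniq // Lu /=.
  rewrite sorted_map; apply: sort_sorted => p q; exact: leq_total.
exists (map gen L); split.
- by rewrite map_inj_in_uniq // => p q; rewrite !LE; apply: gen_inj.
- move=> m; rewrite (mingen_homog K (@sqf_edge_sum_mdeg n (n./2 - 1))) genE.
  split=> [/mapP[p]|[p pp ->]]; first by rewrite LE => pp ->; exists p.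
  by apply: map_f; rewrite LE.
move=> i /andP[_]; rewrite size_map => iL.
have x0 : 'I_n * 'I_n by have n0 : 0 < n by [lia]; split; exact: Ordinal n0.
rewrite (nth_map x0) //; set q := nth x0 L i.
have : q \in L by apply: mem_nth.
rewrite LE inE => /andP[q1 q2].
apply: colon_variables => e; rewrite -map_take => /mapP[p + ->].
rewrite (mem_take_sorted x0 _ Ls iL) LE -/q => /andP[pp]; move: (pp); rewrite inE.
have earlier r v : r \in pairs -> key r < key q ->
    (gen r <= U_(v) + gen q)%MM -> upset (fun m => m \in map gen (take i L)) (U_(v) + gen q)%MM.
  move=> rp rq rle; exists (gen r) => //; apply: map_f.
  by rewrite (mem_take_sorted x0 _ Ls iL) LE rp.
move=> /andP[p1 p2]; rewrite key_lt => pq.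
(* Equal first entries: multiplying by the variable of [q.2] leaves only [q.1] missing, and this
   product is divisible by the earlier generator [gen p]. *)
have [p1q1|p1q1] := eqVneq p.1 q.1.
  move: pq; rewrite p1q1 eqxx ltnn /= => pq.
  exists q.2; last apply: (earlier p) => //.
  - by rewrite /gen !mnmE !inE -!val_eqE p1q1 /=; lia.
  - by rewrite key_lt p1q1 eqxx pq orbT.
  by apply/mnm_lepP=> v; rewrite mnmDE mnm1E /gen !mnmE !inE p1q1 -!val_eqE /=; lia.
(* Smaller first entry: multiplying by the variable of [q.1] leaves only [q.2] missing, and the
   generator of ([p.1], [q.2]), earlier than q, divides the product. *)
move: pq; rewrite (negbTE p1q1) orbF => pq.
exists q.1; last apply: (earlier (p.1, q.2)) => //=.
- by rewrite /gen !mnmE !inE -!val_eqE /=; lia.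
- by rewrite inE p1.
- by rewrite key_lt pq.
by apply/mnm_lepP=> v; rewrite mnmDE mnm1E /gen !mnmE !inE -!val_eqE /=; lia.
Qed.

End EvenCycle.

Theorem theorem4p4 (K : fieldType) (n : nat) (n_gt3 : 3 < n) :
  let nu := matching_number (cycle_graph n) in
  let nu0 := restricted_matching_number (cycle_graph n) in
  let I := edge_ideal K (cycle_graph n) in
  (forall k : nat, 1 <= k ->
     (ext_lt 1 (lin_index (squarefree_power I k)) <-> nu0 <= k)) /\
  nu = n./2 /\
  nu0 = nu - 1 /\
  (~~ odd n -> linear_quotients (squarefree_power I nu0)) /\
  (odd n -> lin_index (squarefree_power I nu0) = Some 2).
Proof.
move=> nu nu0 I.
have -> : nu = n./2 by apply: matching_number_cycle.
have -> : nu0 = n./2 - 1 by apply: restricted_matching_number_cycle.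
have IE k : squarefree_power I k = monomial_ideal (sqf_edge_sum (cycle_graph n) k).
  by apply: squarefree_power_edge_ideal => [u|u v]; [apply: cycle_irr|apply: cycle_sym].
split; [|split=> //; split=> //; split=> par]; last 2 first.
- by rewrite IE; apply: linear_quotients_even.
- rewrite IE; apply: lin_index_eq2.
  + rewrite monomial_ideal_zero => E0.
    have x0P : 0 < n by lia.
    have x1P : 1 < n by lia.
    have [//|e /E0//] := @upset_odd_pair n n_gt3 (Ordinal x0P) (Ordinal x1P) par.
  + by apply: steps_linear_cycle; lia.
  + exact: not_steps_linear_odd.
move=> k k1; rewrite IE lin_index_gt1; split=> [|nk].
  (* Below [nu0] the ideal is nonzero, as the path 0, ..., 2k - 1 gives a generator, so an index
     above 1 would require linear relations. *)
  rewrite leqNgt => H; apply/negP=> kn; case: H; last exact: not_steps_linear_lt.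
  rewrite monomial_ideal_zero.
  move/(_ (mesym1 [set v : 'I_n | 0 <= v < 0 + k.*2])); apply; split.
    by apply: edge_sum_segment; lia.
  exact: squarefree_mesym1.
(* Above n / 2 there is no squarefree monomial of degree 2k: the ideal is zero and has index
   infinity by convention. *)
have [kn|kn] := leqP k n./2; first by right; apply: steps_linear_cycle.
left; rewrite monomial_ideal_zero => m [/edge_sum_mdeg mk /squarefreeP[W mW]].
have := max_card (mem W); rewrite card_ord -mdeg_mesym1 -mW mk; lia.
Qed.
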